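(* Let $f$ be a valid function on $A\times\mathbb{R}$ that is strictly log-concave with respect to $y$. Let $\{G_n\}_{n\in\mathbb{N}}$ be a sequence of (deterministic) comparison graphs, $G_n$ having vertex set $[n]=\{1,\dots,n\}$ and $n_{ij}=n_{ji}$ edges between $i\neq j$, and let the comparison outcomes $X_{ij}^{(t)}$ be generated as described in the context from latent scores $u\in\mathbb{R}^n$ with $u_1=0$ and dynamic range $M_n$. Let $g(x;y)=\frac{\partial}{\partial y}\log f(x;y)$, $g_2(x;y)=\frac{\partial}{\partial y}g(x;y)$, $C_n^{(2)}=\sup_{x\in A,|y|\le M_n}|g(x;y)|$, $C_n^{(3)}=\inf_{x\in A,|y|\le M_n+1}|g_2(x;y)|$. Suppose that the following conditions hold: (i) for every non-empty $V_1\subsetneq[n]$ there exist $i\in V_1$, $j\in[n]\setminus V_1$ and $t\in\{1,\dots,n_{ij}\}$ with $X_{ij}^{(t)}>0$; (ii) with $X_y$ denoting a random variable with density (mass function) $f(\cdot\,;y)$, there is a constant $C_n^{(4)}$ such that $$\sup_{|y|\le M_n}\bigl\|g(X_y;y)-\mathbb{E}[g(X_y;y)]\bigr\|_{\psi_2}\le C_n^{(4)}.$$ Let $\omega_n=\min\{C_n^{(4)}/C_n^{(3)},\,C_n^{(2)}/C_n^{(3)}\}$. If $\{G_n\}$ is rapidly expanding with rate $\{\omega_n\}$, that is, $$\Delta_n^{RE}:=\omega_n\Gamma_{G_n}^{RE}\to0\quad\text{as }n\to\infty,$$ where $\Gamma^{RE}_{G_n}$ is defined in the context, then there exists an absolute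 constant $C>0$ such that for sufficiently large $n$, with probability at least $1-n^{-2}$, the maximum likelihood estimator $\widehat{u}=\arg\max_{v\in\mathbb{R}^n,\,v_1=0}l(v)$ uniquely exists and satisfies $$\|\widehat{u}-u\|_\infty\le C\Delta_n^{RE}.$$ In other words, $\widehat{u}$ is a uniformly consistent estimator for $u$.
   Context: **Link function.** $A\subset\mathbb{R}$ is symmetric ($A=-A$) and is either continuous (integrals over $A$ are with respect to Lebesgue measure) or discrete (integrals $\int\cdot\,dx$ are read as sums over $A$). A function $f:A\times\mathbb{R}\to(0,\infty)$ is *valid* if: (1) $\int_A f(x;y)\,dx=1$ for every $y\in\mathbb{R}$; (2) $f(x;y)=f(-x;-y)$ for all $(x,y)\in A\times\mathbb{R}$; (3) for $x<0$, $f(x;y)$ is decreasing in $y$ and $f(x;y)\to0$ as $y\to\infty$; (4) $\sup_{y\in\mathbb{R}}f(x;y)<\infty$ for every $x\in A$. $f$ is *strictly log-concave with respect to $y$* if for every $x\in A$, $\log f(x;y)$ is twice differentiable in $y$ and $\frac{\partial^2}{\partial y^2}\log f(x;y)<0$ for all $y\in\mathbb{R}$. **Sub-gaussian norm.** $\|Z\|_{\psi_2}=\inf\{t\ge0:\mathbb{E}[\exp(Z^2/t^2)]\le2\}$. **Outcomes and likelihood.** For each $n$, $u=(u_1,\dots,u_n)\in\mathbb{R}^n$ is the latent score vector and $M_n=\max_{i,j}|u_i-u_j|$. The comparison graph does not depend on $u$. The outcomes $X_{ij}^{(t)}$ ($i<j$, $1\le t\le n_{ij}$) are independent with density (mass function)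 $f(\cdot\,;u_i-u_j)$, and $X_{ji}^{(t)}=-X_{ij}^{(t)}$. The log-likelihood is $l(v)=\frac12\sum_{i\ne j}\sum_{t=1}^{n_{ij}}\log f(X_{ij}^{(t)};v_i-v_j)$. **Graph notions.** Graphs $G=(V,E)$ are undirected and connected; multiple edges are allowed and counted with multiplicity. For $U_1,U_2\subset V$, $\mathcal{E}(U_1,U_2)$ is the set of edges between $U_1$ and $U_2$, and $\partial U=\mathcal{E}(U,U^\complement)$. For non-empty $U\subsetneq V$, $h_G(U)=\dfrac{|\partial U|}{\min\{|U|,|U^\complement|\}}$. A sequence of non-empty vertex sets $A_1\subsetneq A_2\subsetneq\dots\subsetneq A_K\subseteq V$ is *admissible* if $|\mathcal{E}(A_k,A_{k+1}\setminus A_k)|\ge|\partial A_k|/2$ for all $k<K$; $\mathscr{A}(G)$ is the set of admissible sequences of $G$. For $G_n$ with $n$ vertices, $$\Gamma_{G_n}^{RE}=\max_{\{A_k\}_{k=1}^K\in\mathscr{A}(G_n)}\ \sum_{k=1}^{K-1}\sqrt{\frac{\log n}{h_{G_n}(A_k)}} .$$ *)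

(* Defs.v *)
From HB Require Import structures.
From mathcomp Require Import all_boot all_order all_algebra finmap.
From mathcomp Require Import all_classical all_reals all_analysis.

Set Implicit Arguments.
Unset Strict Implicit.
Unset Printing Implicit Defensive.

Import Order.TTheory GRing.Theory Num.Theory.
Import numFieldNormedType.Exports.

Local Open Scope classical_set_scope.
Local Open Scope ring_scope.

Variant outcome_kind := ContinuousOutcomes | DiscreteOutcomes.

Definition outcome_space (R : realType) (k : outcome_kind) (A : set R) : Prop :=
  (forall x, A x -> A (- x)) /\
  match k with
  | ContinuousOutcomes => measurable A
  | DiscreteOutcomes => countable A
  end.

(* To be used for nonnegative integrands only, as \esum requires. *)
Definition outcome_integral (R : realType) (k : outcome_kind) (D : set R)
    (h : R -> R) : \bar R :=
  match k with
  | ContinuousOutcomes => (\int[@lebesgue_measure R]_(x in D) (h x)%:E)%E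
  | DiscreteOutcomes => \esum_(x in D) (h x)%:E
  end.

(* A function on A x R is represented by a total function; its values at x
   outside A are never used. *)
Record valid_link (R : realType) (k : outcome_kind) (A : set R)
    (f : R -> R -> R) : Prop := ValidLink {
  link_gt0 : forall x y, A x -> 0 < f x y;
  link_measurable : forall y, measurable_fun A (f ^~ y);
  link_mass1 : forall y, outcome_integral k A (f ^~ y) = 1%:E;
  link_sym : forall x y, A x -> f x y = f (- x) (- y);
  link_decr : forall x, A x -> x < 0 ->
    {homo f x : y y' / y <= y' >-> y' <= y};
  link_lim0 : forall x, A x -> x < 0 -> f x y @[y --> +oo] --> (0 : R);
  link_bounded : forall x, A x -> has_ubound (range (f x)) }.

Definition score (R : realType) (f : R -> R -> R) (x y : R) : R :=
  derive1 (fun z : R => ln (f x z)) y.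

Definition score2 (R : realType) (f : R -> R -> R) (x y : R) : R :=
  derive1 (score f x) y.

Definition strictly_log_concave (R : realType) (A : set R) (f : R -> R -> R)
    : Prop :=
  forall x y : R, A x ->
    [/\ derivable (fun z : R => ln (f x z)) y 1,
        derivable (score f x) y 1 & score2 f x y < 0].

Definition has_density (R : realType) d (T : measurableType d)
    (P : probability T R) (k : outcome_kind) (A : set R) (p : R -> R)
    (X : {RV P >-> R}) : Prop :=
  (forall w, A (X w)) /\
  forall B : set R, measurable B ->
    P (X @^-1` B) = outcome_integral k (A `&` B) p.

Definition mutually_independent (R : realType) d (T : measurableType d)
    (P : probability T R) (I : choiceType) (D : set I) (X : I -> T -> R)
    : Prop :=
  forall (J : {fset I}) (B : I -> set R),
    [set` J] `<=` D -> (forall i, measurable (B i)) ->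
    P (\bigcap_(i in [set` J]) (X i @^-1` B i)) =
    (\prod_(i <- J) P (X i @^-1` B i))%E.

(* The infimum is over t > 0: the quotient at t = 0 is meaningless, and with
   x / 0 = 0 it would make the norm vanish identically.  The norm is +oo when
   no t is admissible. *)
Definition psi2_norm (R : realType) d (T : measurableType d)
    (P : probability T R) (Z : T -> R) : \bar R :=
  ereal_inf [set t%:E | t in
    [set t : R | 0 < t /\ ('E_P[fun w => expR (Z w ^+ 2 / t ^+ 2)] <= 2%:E)%E]].

(* [mult i j] is the number of edges between i and j; vertex i of {1, ..., n}
   is the ordinal i - 1. *)
Record multigraph (n : nat) := Multigraph {
  mult :> 'I_n -> 'I_n -> nat;
  mult_sym : forall i j, mult i j = mult j i;
  mult_irr : forall i, mult i i = 0%N }.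

Definition connected_graph n (G : multigraph n) : Prop :=
  forall i j, connect (fun a b => 0 < G a b)%N i j.

Definition edges_between n (G : multigraph n) (U1 U2 : {set 'I_n}) : nat :=
  (\sum_(p : 'I_n * 'I_n | (p.1 < p.2) &&
      ((p.1 \in U1) && (p.2 \in U2) || (p.1 \in U2) && (p.2 \in U1)))
    G p.1 p.2)%N.

Definition boundary n (G : multigraph n) (U : {set 'I_n}) : nat :=
  edges_between G U (~: U).

Definition expansion (R : realType) n (G : multigraph n) (U : {set 'I_n}) : R :=
  (boundary G U)%:R / (minn #|U| #|~: U|)%:R.

Definition admissible n (G : multigraph n) (s : seq {set 'I_n}) : bool :=
  [&& s != [::], all (fun U : {set 'I_n} => U != finset.set0) s &
      sorted (fun U V : {set 'I_n} => (U \proper V) &&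
                (boundary G U <= 2 * edges_between G U (V :\: U))%N) s].

(* The last set of the sequence does not contribute. *)
Definition GammaRE (R : realType) n (G : multigraph n) : \bar R :=
  ereal_sup [set (\sum_(0 <= k < (size s).-1)
      Num.sqrt (ln n%:R / expansion R G (nth finset.set0 s k)))%:E
    | s in [set s : seq {set 'I_n} | admissible G s]].

Definition dynamic_range (R : realType) n (u : 'rV[R]_n) : R :=
  \big[Num.max/0]_(i < n) \big[Num.max/0]_(j < n) `|u 0 i - u 0 j|.

Definition normalized (R : realType) n (v : 'rV[R]_n) : Prop :=
  forall i : 'I_n, val i = 0%N -> v 0 i = 0.

Definition comparison_outcomes (R : realType) (k : outcome_kind) (A : set R)
    (f : R -> R -> R) n (G : multigraph n) (u : 'rV[R]_n)
    d (T : measurableType d) (P : probability T R)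
    (X : 'I_n -> 'I_n -> nat -> {RV P >-> R}) : Prop :=
  [/\ mutually_independent P
        [set e : 'I_n * 'I_n * nat |
          (e.1.1 < e.1.2)%N /\ (e.2 < G e.1.1 e.1.2)%N]
        (fun e => X e.1.1 e.1.2 e.2 : T -> R),
      forall (i j : 'I_n) t, (i < j)%N -> (t < G i j)%N ->
        has_density k A (f ^~ (u 0 i - u 0 j)) (X i j t)
    & forall (i j : 'I_n) t w, i != j -> (t < G i j)%N ->
        X j i t w = - X i j t w].

(* [x i j t] is a realization of the outcomes. *)
Definition loglik (R : realType) (f : R -> R -> R) n (G : multigraph n)
    (x : 'I_n -> 'I_n -> nat -> R) (v : 'rV[R]_n) : R :=
  2^-1 * \sum_(i < n) \sum_(j < n | i != j) \sum_(t < G i j)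
    ln (f (x i j t) (v 0 i - v 0 j)).

Definition is_mle (R : realType) (f : R -> R -> R) n (G : multigraph n)
    (x : 'I_n -> 'I_n -> nat -> R) (v : 'rV[R]_n) : Prop :=
  normalized v /\
  forall v' : 'rV[R]_n, normalized v' -> loglik f G x v' <= loglik f G x v.

(* `|_| on 'rV[R]_n is the sup norm. *)
Definition mle_within (R : realType) (f : R -> R -> R) n (G : multigraph n)
    (x : 'I_n -> 'I_n -> nat -> R) (u : 'rV[R]_n) (r : \bar R) : Prop :=
  exists uhat : 'rV[R]_n,
    unique (is_mle f G x) uhat /\ (`|uhat - u|%:E <= r)%E.

Definition strongly_connected (R : realType) n (G : multigraph n)
    (x : 'I_n -> 'I_n -> nat -> R) : Prop :=
  forall V1 : {set 'I_n}, V1 != finset.set0 -> V1 \proper [set: 'I_n]%SET ->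
    exists i j t, [/\ i \in V1, j \notin V1, (t < G i j)%N & 0 < x i j t].

Definition score_sup (R : realType) (A : set R) (f : R -> R -> R) (M : R)
    : \bar R :=
  ereal_sup [set c | exists x y,
    [/\ A x, `|y| <= M & c = `|score f x y|%:E]].

(* The range is widened by 1, so that it still covers the score differences of
   any v close to u. *)
Definition score2_inf (R : realType) (A : set R) (f : R -> R -> R) (M : R)
    : \bar R :=
  ereal_inf [set c | exists x y,
    [/\ A x, `|y| <= M + 1 & c = `|score2 f x y|%:E]].

(* [score_sup] may be +oo; extended division by a zero [score2_inf] gives +oo,
   so such n cannot satisfy a smallness condition on [DeltaRE] below. *)
Definition omega (R : realType) (A : set R) (f : R -> R -> R) (M C4 : R)
    : \bar R :=
  Order.min (C4%:E / score2_inf A f M)%E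
            (score_sup A f M / score2_inf A f M)%E.

Definition DeltaRE (R : realType) (A : set R) (f : R -> R -> R) n
    (G : multigraph n) (u : 'rV[R]_n) (C4 : R) : \bar R :=
  (omega A f (dynamic_range u) C4 * GammaRE R G)%E.

(* Main.v *)
(* Put g = d/dy log f, and for a vertex set U let S_U (v) be the sum of
   g (X_ij; v_i - v_j) over the edges from i in U to j outside U.

   Probability.  The scores g (X_ij; u_i - u_j) are centered and sub-gaussian with
   constant K, a multiple of C4 or of C2.  A Chernoff bound and a union bound over
   all U give, with probability 1 - n^-2, for every proper non-empty U,
     S_U (u) <= 10 K sqrt (|bd U| min (|U|, |U^c|) log n).

   Determinism.  At a maximizer v of the likelihood S_U (v) >= 0 for every U.  Let
   D = v - u and let U be the level set {D >= a}.  Each edge of bd U with gap D_i -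
   D_j > e, e <= 1, contributes at least C3 e to S_U (u) - S_U (v), and the others
   contribute nonnegatively; so at least half of bd U stays inside
   {D >= a - e} for e = (20 K / C3) sqrt (log n / h (U)).  Iterating from the top
   level set produces an admissible sequence exhausting the vertices, whence
   max D - min D <= (20 K / C3) Gamma; as D vanishes at vertex 1 this bounds |v - u|.
   Comparing S_U at two maximizers for the top level set of their difference gives
   uniqueness. *)
Require Import Defs.
From HB Require Import structures.
From mathcomp Require Import all_boot all_order all_algebra finmap.
From mathcomp Require Import all_classical all_reals all_analysis.
From mathcomp Require Import measurable_realfun ring lra zify.

Set Implicit Arguments.
Unset Strict Implicit.
Unset Printing Implicit Defensive.

Import Order.TTheory GRing.Theory Num.Theory.
Import numFieldNormedType.Exports.

Local Open Scope classical_set_scope.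
Local Open Scope ring_scope.

(** * Integration and independence *)

(** Two obstacles shape the proof. The score is not assumed to have mean zero, yet the moment bounds
    need it; centering is extracted from the mass 1 of f(.; y + h) together with strict
    log-concavity. And C3 controls the curvature only up to distance 1 beyond the dynamic range, so
    every level step e must be at most 1: this is why Delta is first brought below 1/80. The union
    bound over exponentially many vertex sets is affordable because the threshold contains min (|U|,
    |U^c|): with m for this minimum, a set fails with probability at most n^(-5m), while at most 2
    n^m sets share the same m. The constant 80 is 20 * 4. In 20 K, 10 is the Chernoff constant and 2
    pays for using only half of the boundary edges; 4 is the loss when sub-gaussianity comes only
    from the bound C2 on the score. *)

Section integral_transfer.
Context d d' (T : measurableType d) (T' : measurableType d') (R : realType).
Import HBNNSimple.

(** [W] acts as a density with respect to [mu]. Approximating [phi] from below by simple functions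
    reduces the claim to level sets, where it is the hypothesis. It serves three purposes: comparing
    two laws ([W] = 1), integrating against a density ([X] = id), and splitting one variable off a
    product ([W] = the remaining factors). *)
Lemma le_integral_transfer (mu : {measure set T -> \bar R})
    (nu : {measure set T' -> \bar R}) (X : T -> T') (W : T -> R) (phi : T' -> R) :
  measurable_fun setT X -> measurable_fun setT W -> (forall x, 0 <= W x) ->
  measurable_fun setT phi -> (forall y, 0 <= phi y) ->
  (forall B, measurable B -> (\int[mu]_(x in X @^-1` B) (W x)%:E <= nu B)%E) ->
  (\int[mu]_x (phi (X x) * W x)%:E <= \int[nu]_y (phi y)%:E)%E.
Proof.
move=> mX mW W0 mphi phi0 leB.
have mEphi : measurable_fun setT (EFin \o phi : T' -> \bar R) by exact/measurable_EFinP.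
pose h := nnsfun_approx measurableT mEphi.
have hphi y : (EFin \o h^~ y) @ \oo --> (phi y)%:E.
  by apply: cvg_nnsfun_approx => //= z _; rewrite lee_fin.
have hle n y : h n y <= phi y.
  rewrite -lee_fin -(cvg_lim _ (hphi y))//.
  apply: lime_ge; first by apply/cvg_ex; exists (phi y)%:E.
  by exists n => //= m nm; rewrite lee_fin; exact/lefP/nd_nnsfun_approx.
have mhX n : measurable_fun setT (h n \o X) by exact: measurableT_comp.
have key n : (\int[mu]_x (h n (X x) * W x)%:E <= \int[nu]_y (phi y)%:E)%E.
  apply: (@le_trans _ _ (\int[nu]_y (h n y)%:E)%E); last first.
    apply: ge0_le_integral => //.
    - by move=> y _; rewrite lee_fin.
    - exact/measurable_EFinP.
    - by move=> y _; rewrite lee_fin.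
  have mpre r : measurable (h n @^-1` [set r]) by exact: measurable_sfunP.
  under eq_integral do rewrite fimfunE fsbig_finite//= mulr_suml -sumEFin.
  rewrite ge0_integral_sum//; last 2 first.
  - move=> r; apply/measurable_EFinP/measurable_funM => //.
    apply: measurable_funM => //; apply: measurableT_comp => //.
  - move=> r x _; rewrite lee_fin mulr_ge0//.
    by have := nnfun_muleindic_ge0 (h n) r (X x); rewrite -EFinM lee_fin.
  under [X in (_ <= X)%E]eq_integral do rewrite fimfunE fsbig_finite//= -sumEFin.
  rewrite ge0_integral_sum//; last 2 first.
  - move=> r; apply/measurable_EFinP; exact: measurable_funM.
  - by move=> r x _; have := nnfun_muleindic_ge0 (h n) r x; rewrite -EFinM lee_fin.
  apply: lee_sum => r _.
  have [r0|r0] := leP 0 r; last first.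
    rewrite (_ : _ @^-1` _ = set0)//; first last.
      by apply/seteqP; split => // y /= yr; have : 0 <= h n y by []; rewrite yr leNgt r0.
    under eq_integral do rewrite indic0 /= mulr0 mul0r.
    under [X in (_ <= X)%E]eq_integral do rewrite indic0 /= mulr0.
    by rewrite !integral0.
  under eq_integral do rewrite -mulrA EFinM.
  under [X in (_ <= X)%E]eq_integral do rewrite EFinM.
  rewrite ge0_integralZl//; last 2 first.
  - apply/measurable_EFinP/measurable_funM => //; apply: measurableT_comp => //.
  - by move=> x _; rewrite lee_fin mulr_ge0.
  rewrite ge0_integralZl//; last by apply/measurable_EFinP; exact: measurable_indic.
  apply: lee_wpmul2l; first by rewrite lee_fin.
  rewrite integral_indic// setIT (le_trans _ (leB _ (mpre r)))//.
  rewrite [in leRHS]integral_mkcond le_eqVlt; apply/orP; left; apply/eqP.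
  apply: eq_integral => x _; rewrite patchE indicE.
  rewrite [X in if X then _ else _](_ : _ = (X x \in h n @^-1` [set r])); last first.
    by apply/idP/idP; rewrite !inE.
  by case: ifP; rewrite ?mul1r ?mul0r.
have -> : (\int[mu]_x (phi (X x) * W x)%:E)%E =
    (\int[mu]_x limn (fun n => (h n (X x) * W x)%:E))%E.
  apply: eq_integral => x _; apply/esym/cvg_lim => //.
  under eq_fun do rewrite EFinM.
  by rewrite EFinM; apply: cvgeZr => //; exact: hphi.
rewrite monotone_convergence//; last 3 first.
- by move=> n; apply/measurable_EFinP/measurable_funM => //; exact: (mhX n).
- by move=> n x _; rewrite lee_fin mulr_ge0 ?W0.
- move=> x _ a b ab; rewrite lee_fin ler_wpM2r//; exact/lefP/nd_nnsfun_approx.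
apply: lime_le; last exact: nearW.
apply: ereal_nondecreasing_is_cvgn => a b ab; apply: ge0_le_integral => //.
- by move=> x _; rewrite lee_fin mulr_ge0.
- by apply/measurable_EFinP/measurable_funM => //; exact: mhX.
- by apply/measurable_EFinP/measurable_funM => //; exact: mhX.
- by move=> x _; rewrite lee_fin ler_wpM2r//; exact/lefP/nd_nnsfun_approx.
Qed.

End integral_transfer.

Section independent_product.
Context (R : realType) d (T : measurableType d) (P : probability T R).

Lemma measurable_prod_seq (I : Type) (L : seq I) (h : I -> T -> R) :
  (forall i, measurable_fun setT (h i)) ->
  measurable_fun setT (fun w => \prod_(i <- L) h i w).
Proof.
move=> mh; elim: L => [|i L IH].
  by under eq_fun do rewrite big_nil; exact: measurable_cst.
by under eq_fun do rewrite big_cons; exact: measurable_funM.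
Qed.

Context (I : choiceType) (D : set I) (X : I -> {RV P >-> R}).
Hypothesis indX : mutually_independent P D (fun i => X i : T -> R).

Let event (J : {fset I}) (B : I -> set R) :=
  \bigcap_(i in [set` J]) (X i @^-1` B i).

Let measurable_event J B : (forall i, measurable (B i)) -> measurable (event J B).
Proof.
move=> mB; apply: fin_bigcap_measurable; first exact: finite_fset.
by move=> i _; exact: measurable_funPTI.
Qed.

(* The functions are introduced one variable at a time; the remaining variables
   are only constrained to lie in measurable sets. *)
Let independent_prod_event (L : seq I) (phi : I -> R -> R) (b : I -> R)
    (J : {fset I}) (B : I -> set R) :
  (forall i, measurable_fun setT (phi i)) -> (forall i y, 0 <= phi i y) ->
  (forall i, 0 <= b i) -> (forall i, measurable (B i)) ->
  uniq L -> (forall i, i \in L -> D i /\ i \notin J) -> [set` J] `<=` D ->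
  (forall i, i \in L -> (\int[P]_w (phi i (X i w))%:E <= (b i)%:E)%E) ->
  (\int[P]_(w in event J B) (\prod_(i <- L) phi i (X i w))%:E
    <= (\prod_(i <- L) b i)%:E * P (event J B))%E.
Proof.
move=> mphi phi0 b0; elim: L J B => [|i L IH] J B mB uL LJ JD leb.
  under eq_integral do rewrite big_nil.
  by rewrite integral_cst ?big_nil//; exact: measurable_event.
have [iL uL'] : i \notin L /\ uniq L by move: uL => /= /andP.
have [Di iJ] := LJ i (mem_head _ _).
have c0 : 0 <= \prod_(j <- L) b j * fine (P (event J B)).
  by rewrite mulr_ge0 ?fine_ge0//; exact: prodr_ge0.
pose nu := mscale (NngNum c0) (distribution P (X i)).
pose W w := \prod_(j <- L) phi j (X j w) * \1_(event J B) w.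
have mE : measurable (event J B) by exact: measurable_event.
have EP : P (event J B) = (fine (P (event J B)))%:E.
  by rewrite fineK// fin_num_measure.
have mprod : measurable_fun setT (fun w => \prod_(j <- L) phi j (X j w)).
  by apply: (@measurable_prod_seq I L (fun j w => phi j (X j w))) => j; exact: measurableT_comp.
have := @le_integral_transfer _ _ _ _ R P nu (X i) W (phi i).
have -> : (\int[P]_w (phi i (X i w) * W w)%:E =
    \int[P]_(w in event J B) (\prod_(j <- i :: L) phi j (X j w))%:E)%E.
  rewrite [RHS]integral_mkcond; apply: eq_integral => w _.
  rewrite patchE /W indicE big_cons.
  by case: ifP => _; rewrite ?mulr1 ?mulr0.
have -> : (\int[nu]_y (phi i y)%:E = (\prod_(j <- L) b j)%:E * P (event J B)
    * \int[P]_w (phi i (X i w))%:E)%E.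
  rewrite ge0_integral_mscale//; last 2 first.
  - exact/measurable_EFinP.
  - by move=> y _; rewrite lee_fin.
  rewrite ge0_integral_distribution; [|exact/measurable_EFinP|by move=> y; rewrite lee_fin].
  by rewrite /= [in RHS]EP EFinM.
move=> transfer; apply: le_trans (transfer _ _ _ _ _ _) _ => //.
- exact: measurable_funM.
- by move=> w; rewrite mulr_ge0//; exact: prodr_ge0.
(* The constraint that [X i] lies in [C] becomes coordinate [i] of a larger event, to which the
   induction hypothesis applies; independence then splits off the probability of [C]. *)
- move=> C mC; pose B' j := if j == i then C else B j.
  have evU : event (i |` J)%fset B' = X i @^-1` C `&` event J B.
    apply/seteqP; split=> w.
      move=> H; split; first by have := H i; rewrite /= /B' eqxx; apply; rewrite !inE eqxx.
      move=> j /= jJ; have := H j; rewrite /= /B'; case: eqP => [ji|_].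
        by rewrite -ji jJ in iJ.
      by apply; rewrite !inE jJ orbT.
    move=> [Hi HJ] j /=; rewrite !inE => /orP[/eqP ->|jJ]; rewrite /B' ?eqxx//.
    case: eqP => [ji|_]; first by rewrite -ji jJ in iJ.
    exact: HJ.
  have mB' j : measurable (B' j) by rewrite /B'; case: ifP.
  have UD : [set` (i |` J)%fset] `<=` D.
    by move=> j /=; rewrite !inE => /orP[/eqP ->//|/JD].
  have := IH (i |` J)%fset B' mB' uL'.
  rewrite evU setIC => /(_ _ UD) H.
  rewrite integral_mkcond.
  have -> : (\int[P]_x ((fun x0 => (W x0)%:E) \_ (X i @^-1` C)) x =
    \int[P]_(w in event J B `&` X i @^-1` C) (\prod_(j <- L) phi j (X j w))%:E)%E.
    rewrite [RHS]integral_mkcond; apply: eq_integral => w _.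
    rewrite !patchE in_setI /W indicE; case: (w \in X i @^-1` C) => /=; last by rewrite andbF.
    by rewrite andbT; case: ifP => _; rewrite ?mulr1 ?mulr0.
  apply: (le_trans (H _ _)).
  + move=> j jL; have [Dj jJ] := LJ j (mem_behead (s := i :: L) jL).
    split=> //; rewrite !inE (negbTE jJ) orbF; apply: contraNN iL => /eqP <-//.
  + by move=> j jL; apply: leb; rewrite inE jL orbT.
  + rewrite /nu /= /mscale /= /distribution /pushforward EFinM -EP -muleA.
    apply: lee_wpmul2l; first by rewrite lee_fin; exact: prodr_ge0.
    have := indX UD mB'; rewrite -/(event _ _) evU setIC => ->.
    rewrite big_fsetU1//= /B' eqxx muleC.
    rewrite (_ : P (event J B) = (\prod_(j <- J) P (X j @^-1` B j))%E); last exact: indX.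
    rewrite (eq_big_seq (fun j => P (X j @^-1` B j)))// => j jJ.
    by case: eqP => // ji; rewrite -ji jJ in iJ.
- rewrite muleC big_cons EFinM -muleA; apply: lee_wpmul2r.
    by rewrite mule_ge0// lee_fin; exact: prodr_ge0.
  by apply: leb; exact: mem_head.
Qed.

Lemma independent_prod_le (L : seq I) (phi : I -> R -> R) (b : I -> R) :
  (forall i, measurable_fun setT (phi i)) -> (forall i y, 0 <= phi i y) ->
  (forall i, 0 <= b i) -> uniq L -> (forall i, i \in L -> D i) ->
  (forall i, i \in L -> (\int[P]_w (phi i (X i w))%:E <= (b i)%:E)%E) ->
  (\int[P]_w (\prod_(i <- L) phi i (X i w))%:E <= (\prod_(i <- L) b i)%:E)%E.
Proof.
move=> mphi phi0 b0 uL LD leb.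
have := @independent_prod_event L phi b fset0 (fun=> setT) mphi phi0 b0.
have -> : event fset0 (fun=> setT) = setT.
  by apply/seteqP; split => // w _ j.
rewrite probability_setT mule1; apply => //.
by move=> i /LD.
Qed.

End independent_product.

(** * Link functions and moments of the score *)

Lemma MVT_line (R : realType) (F dF : R -> R) (a b : R) :
  (forall y : R, is_derive y 1 F (dF y)) -> a < b ->
  exists c, [/\ a < c, c < b & F b - F a = dF c * (b - a)].
Proof.
move=> hF ab.
have [|c cab Fc] := @MVT R F dF a b ab (fun x _ => hF x).
  by apply: derivable_within_continuous => x _; case: (hF x).
by exists c; split => //; rewrite (itvP cab).
Qed.

Section link_calculus.
Context (R : realType) (k : outcome_kind) (A : set R) (f : R -> R -> R).
Hypotheses (hA : outcome_space k A) (hf : valid_link k A f)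
  (hconc : strictly_log_concave A f).

Lemma measurable_outcome_space : measurable A.
Proof.
case: hA => _; case: (k) => // cA.
by apply: countable_measurable => // x _; exact: measurable_set1.
Qed.

Lemma is_derive_ln_link (x y : R) : A x ->
  is_derive y 1 (fun z : R => ln (f x z)) (score f x y).
Proof.
by move=> Ax; have [dl _ _] := hconc y Ax; rewrite /score derive1E; exact/derivableP.
Qed.

Lemma is_derive_score (x y : R) : A x -> is_derive y 1 (score f x) (score2 f x y).
Proof.
by move=> Ax; have [_ ds _] := hconc y Ax; rewrite /score2 derive1E; exact/derivableP.
Qed.

(** The chain rule applied to the symmetry of the link; it allows an edge to be read in either
    direction. *)
Lemma score_opp x y : A x -> score f (- x) (- y) = - score f x y.
Proof.
move=> Ax; have E : (fun z => ln (f (- x) z)) = (fun z => ln (f x z)) \o -%R.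
  apply/funext => z /=; rewrite (link_sym hf z) ?opprK//.
  by case: hA => + _; apply.
have D : is_derive (- - y) 1 (fun z : R => ln (f x z)) (score f x y).
  by rewrite opprK; exact: is_derive_ln_link.
have H := is_derive1_comp D (is_deriveNid (- y : R) (1 : R)).
rewrite -[RHS]mulrN1 -(@derive_val _ _ _ _ _ _ _ H) -derive1E.
by rewrite /score E.
Qed.

Lemma score_decr x : A x -> {homo score f x : y y' / y < y' >-> y' < y}.
Proof.
move=> Ax y y' yy'.
have [c [_ _ E]] := MVT_line (fun y => is_derive_score y Ax) yy'.
rewrite -subr_lt0 E pmulr_llt0 ?subr_gt0//.
by have [_ _] := hconc c Ax.
Qed.

Lemma score_decrW x : A x -> {homo score f x : y y' / y <= y' >-> y' <= y}.
Proof.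
move=> Ax y y'; rewrite le_eqVlt => /predU1P[->//|yy'].
exact/ltW/score_decr.
Qed.

Lemma ln_link_lt_tangent x y h : A x -> h != 0 ->
  ln (f x (y + h)) < ln (f x y) + h * score f x y.
Proof.
move=> Ax h0; have hd z := is_derive_ln_link z Ax.
case: (ltgtP h 0) => [hn|hp|/eqP]; last by rewrite (negbTE h0).
  have [|c [c1 c2 E]] := MVT_line hd (a := y + h) (b := y); first by rewrite gtrDl.
  have -> : ln (f x (y + h)) = ln (f x y) + h * score f x c.
    by apply/eqP; rewrite eq_sym -subr_eq0; apply/eqP; move: E; rewrite -/(ln _); lra.
  by rewrite ltrD2l ltr_nM2l//; exact: score_decr.
have [|c [c1 c2 E]] := MVT_line hd (a := y) (b := y + h); first by rewrite ltrDl.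
have -> : ln (f x (y + h)) = ln (f x y) + h * score f x c.
  by move: E; lra.
by rewrite ltrD2l ltr_pM2l//; exact: score_decr.
Qed.

(** The mean value point lies within M + 1 because D <= 1, so the lower bound on the curvature
    applies there. *)
Lemma score_gap x y c D M : A x -> `|y| <= M -> 0 <= D -> D <= 1 ->
  (forall z, `|z| <= M + 1 -> c <= `|score2 f x z|) ->
  c * D <= score f x y - score f x (y + D).
Proof.
move=> Ax yM; rewrite le_eqVlt => /predU1P[<-|D0] D1 hc.
  by rewrite mulr0 addr0 subrr.
have [|z [z1 z2 E]] := MVT_line (fun y => is_derive_score y Ax) (a := y) (b := y + D).
  by rewrite ltrDl.
have -> : score f x y - score f x (y + D) = - score2 f x z * D by move: E; lra.
apply: ler_wpM2r; first exact: ltW.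
have [_ _ s2] := hconc z Ax; rewrite -(ltr0_norm s2); apply: hc.
move: yM; rewrite !ler_norml => /andP[y1 y2]; apply/andP; split; lra.
Qed.

(** Measurability is given only for each section f(.; y), so the derivative in y is reached as a
    limit of difference quotients along the steps 1 / (m + 1). *)
Lemma measurable_score y : measurable_fun A (score f ^~ y).
Proof.
pose h (m : nat) x : R := m.+1%:R^-1^-1 * (ln (f x (m.+1%:R^-1 + y)) - ln (f x y)).
apply: (@measurable_fun_cvg _ _ _ _ h).
  move=> m; apply: measurable_funM; first exact: measurable_cst.
  by apply: measurable_funB; apply: measurableT_comp => //; exact: (link_measurable hf).
move=> x Ax; have [dl _ _] := hconc y Ax.
have : h0^-1 *: (ln (f x (h0 + y)) - ln (f x y)) @[h0 --> 0^'] --> score f x y.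
  rewrite /score /derive1; move: dl; rewrite /derivable.
  set g1 := (X in cvg (X @ _)).
  have -> : g1 = (fun h0 => h0^-1 *: (ln (f x (h0 + y)) - ln (f x y))) => //.
  by apply/funext => t; rewrite /g1 /= [t%:A]mulr1.
move=> /cvgr_dnbhsP /(_ (fun m => m.+1%:R^-1)); apply; split.
  by move=> m; rewrite invr_eq0 pnatr_eq0.
exact: cvg_harmonic.
Qed.

End link_calculus.

(** * Moment generating functions of sub-gaussian variables *)

Lemma expR_le_quad (R : realType) (x : R) :
  expR x <= 1 + x + x ^+ 2 * expR `|x|.
Proof.
have h1 : expR x - 1 <= x * expR x.
  rewrite lerBlDr -(@ler_pM2r _ (expR (- x))) ?expR_gt0//.
  rewrite mulrDl -!mulrA -expRD subrr expR0 !mulr1 mul1r.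
  by have := expR_ge1Dx (- x); lra.
suff : x * (expR x - 1) <= x ^+ 2 * expR `|x| by move: h1; rewrite mulrBr mulr1; lra.
have [x0|x0] := leP 0 x.
  rewrite expr2 -mulrA; apply: ler_wpM2l => //.
  by rewrite ger0_norm.
rewrite -(opprK (_ * _)) -mulNr -mulrN opprB expr2 -[x * x]mulrNN -mulrA.
apply: ler_wpM2l; first by rewrite oppr_ge0 ltW.
have := expR_ge1Dx x => h.
apply: (@le_trans _ _ (- x * 1)); first by lra.
by apply: ler_wpM2l; rewrite ?oppr_ge0 ?(ltW x0)// -expR0 ler_expR.
Qed.

(** The term linear in z is kept exact, so that centering removes it. With a = lam^2 t^2 and s = z^2
    / t^2, the quadratic remainder is a s exp |lam z| with |lam z| <= (a + s) / 2; the factor s is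
    absorbed by s <= 2 exp (s / 2), leaving exp s, whose mean is at most 2. *)
Lemma expR_le_subgaussian (R : realType) (t z lam : R) : 0 < t ->
  expR (lam * z) <=
  1 + lam * z + 2 * (lam ^+ 2 * t ^+ 2) * expR (lam ^+ 2 * t ^+ 2 / 2)
    * expR (z ^+ 2 / t ^+ 2).
Proof.
move=> t0; set a := lam ^+ 2 * t ^+ 2; set s := z ^+ 2 / t ^+ 2.
have a0 : 0 <= a by rewrite mulr_ge0// sqr_ge0.
have s0 : 0 <= s by rewrite divr_ge0// sqr_ge0.
have as_ : (lam * z) ^+ 2 = a * s.
  by rewrite /a /s exprMn; field; rewrite gt_eqF.
have xas : `|lam * z| <= a / 2 + s / 2.
  rewrite -(@ler_pXn2r _ 2)// ?nnegrE//; last by lra.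
  rewrite real_normK ?num_real// as_; have := sqr_ge0 (a - s); rewrite !expr2; lra.
apply: (le_trans (expR_le_quad _)); rewrite lerD2l as_ .
have s2 : s <= 2 * expR (s / 2) by have := expR_ge1Dx (s / 2); lra.
have -> : 2 * a * expR (a / 2) * expR s = a * (2 * expR (s / 2)) * expR (a / 2 + s / 2).
  have -> : expR s = expR (s / 2) * expR (s / 2) by rewrite -expRD; congr expR; lra.
  by rewrite expRD; ring.
apply: ler_pM => //; first by rewrite mulr_ge0.
  exact: ler_wpM2l.
by rewrite ler_expR.
Qed.

Section subgaussian.
Context (R : realType) d (T : measurableType d) (P : probability T R).

Lemma subgaussian_mgf (g : T -> R) (t : R) :
  measurable_fun setT g -> 0 < t ->
  ('E_P[fun w => expR ((g w - fine 'E_P[g]) ^+ 2 / t ^+ 2)] <= 2%:E)%E ->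
  forall lam : R, ('E_P[fun w => expR (lam * g w)]
    <= (expR (lam * fine 'E_P[g] + 5 * lam ^+ 2 * t ^+ 2))%:E)%E.
Proof.
move=> mg t0; rewrite !unlock => hE lam.
set m := fine _ in hE *.
pose Z w := g w - m.
have mZ : measurable_fun setT Z by exact: measurable_funB.
pose e w := expR (Z w ^+ 2 / t ^+ 2).
have me : measurable_fun setT e.
  apply: measurableT_comp => //; apply: measurable_funM => //.
  exact: measurable_funX.
have ie : P.-integrable setT (EFin \o e).
  apply/integrableP; split; first exact/measurable_EFinP.
  under eq_integral do rewrite /= ger0_norm ?expR_ge0//.
  by apply: le_lt_trans hE _; rewrite ltry.
(* [fine] would return 0 on an infinite expectation, so m is the mean of g only once g is
   integrable. Integrability follows from |Z| <= t exp (Z^2 / t^2). *)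
have iZ : P.-integrable setT (EFin \o Z).
  apply: (@le_integrable _ _ _ _ _ measurableT _ (fun w => (t * e w)%:E)).
  - exact/measurable_EFinP.
  - move=> w _; rewrite /= lee_fin.
    rewrite [leRHS]ger0_norm; last by rewrite mulr_ge0// ?expR_ge0 ?ltW.
    rewrite mulrC -ler_pdivrMr//.
    have : `|Z w| / t <= 1 + (`|Z w| / t) ^+ 2.
      by have := sqr_ge0 (`|Z w| / t - 1); have := sqr_ge0 (`|Z w| / t); rewrite !expr2; lra.
    move/le_trans; apply; rewrite exprMn exprVn real_normK ?num_real//.
    exact: expR_ge1Dx.
  - under eq_fun do rewrite EFinM.
    exact: integrableZl.
have ig : P.-integrable setT (EFin \o g).
  have -> : EFin \o g = (EFin \o Z) \+ (EFin \o cst m).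
    by apply/funext => w /=; rewrite -EFinD /Z subrK.
  by apply: integrableD => //; exact: finite_measure_integrable_cst.
have int_cst (r : R) : (\int[P]_w r%:E = r%:E)%E.
  by have /= -> := integral_cst P measurableT r%:E; rewrite probability_setT mule1.
have EZ : (\int[P]_w (Z w)%:E = 0)%E.
  rewrite /Z; under eq_integral do rewrite EFinB.
  rewrite integralB_EFin//; last exact: finite_measure_integrable_cst.
  have fing : (\int[P]_w (g w)%:E)%E \is a fin_num by exact: integrable_fin_num.
  by rewrite int_cst /m fineK// subee.
pose c := 2 * (lam ^+ 2 * t ^+ 2) * expR (lam ^+ 2 * t ^+ 2 / 2).
have c0 : 0 <= c.
  by rewrite /c mulr_ge0 ?expR_ge0// mulr_ge0 ?ler0n// mulr_ge0 ?sqr_ge0.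
have hZ : (\int[P]_w (expR (lam * Z w))%:E <= (1 + c * 2)%:E)%E.
  apply: (@le_trans _ _ (\int[P]_w (1 + lam * Z w + c * e w)%:E)%E).
    apply: ge0_le_integral => //.
    - by apply/measurable_EFinP; apply: measurableT_comp => //; exact: measurable_funM.
    - apply/measurable_EFinP; apply: measurable_funD; last exact: measurable_funM.
      by apply: measurable_funD => //; exact: measurable_funM.
    - by move=> w _; rewrite lee_fin; exact: expR_le_subgaussian.
  have icst : P.-integrable setT (EFin \o cst (1 : R)) by exact: finite_measure_integrable_cst.
  have ilZ : P.-integrable setT (fun w => (lam * Z w)%:E).
    by under eq_fun do rewrite EFinM; exact: integrableZl.
  have ice : P.-integrable setT (fun w => (c * e w)%:E).
    by under eq_fun do rewrite EFinM; exact: integrableZl.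
  under eq_integral do rewrite !EFinD.
  rewrite integralD//; last exact: integrableD.
  rewrite integralD// int_cst.
  under eq_integral do rewrite EFinM.
  under [X in (_ + X <= _)%E]eq_integral do rewrite EFinM.
  rewrite !integralZl// EZ mule0 adde0 EFinD leeD2l//.
  by rewrite (EFinM c 2); apply: lee_wpmul2l => //; rewrite lee_fin.
have -> : (\int[P]_w (expR (lam * g w))%:E =
    (expR (lam * m))%:E * \int[P]_w (expR (lam * Z w))%:E)%E.
  rewrite -ge0_integralZl//; last first.
    by apply/measurable_EFinP; apply: measurableT_comp => //; exact: measurable_funM.
  by apply: eq_integral => w _; rewrite -EFinM -expRD -mulrDr /Z addrC subrK.
apply: (@le_trans _ _ ((expR (lam * m))%:E * (1 + c * 2)%:E)%E).
  by apply: lee_wpmul2l => //; rewrite lee_fin expR_ge0.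
rewrite -EFinM lee_fin expRD ler_wpM2l ?expR_ge0// /c.
(* With a = lam^2 t^2 the chain is 1 + 4 a exp (a/2) <= exp (a/2) (1 + 4 a) <= exp (a/2) exp (4 a);
   the second a/2 is slack that rounds the constant up to 5. *)
have -> : 5 * lam ^+ 2 * t ^+ 2 =
    lam ^+ 2 * t ^+ 2 / 2 + 4 * (lam ^+ 2 * t ^+ 2) + lam ^+ 2 * t ^+ 2 / 2 by lra.
have : 0 <= lam ^+ 2 * t ^+ 2 by rewrite mulr_ge0 ?sqr_ge0.
move: (lam ^+ 2 * t ^+ 2) => a a0.
rewrite 2!expRD.
have e1 : 1 <= expR (a / 2) by rewrite -expR0 ler_expR divr_ge0.
have e2 := expR_ge1Dx (4 * a).
have e3 : expR (a / 2) * (1 + 4 * a) <= expR (a / 2) * expR (4 * a).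
  by apply: ler_wpM2l; rewrite ?expR_ge0.
have : expR (a / 2) * expR (4 * a) * 1 <= expR (a / 2) * expR (4 * a) * expR (a / 2).
  by apply: ler_wpM2l; rewrite ?mulr_ge0 ?expR_ge0.
move: e1 e3; nra.
Qed.

End subgaussian.

(** * Integrals against a law with a density *)

Section density.
Context (R : realType) (k : outcome_kind) (A : set R).
Hypothesis hA : outcome_space k A.

Lemma measurable_comp_density d (T : measurableType d) (P : probability T R)
    (p : R -> R) (Y : {RV P >-> R}) (g : R -> R) :
  has_density k A p Y -> measurable_fun A g -> measurable_fun setT (g \o Y).
Proof.
move=> [AY _] mg; apply: (@measurable_comp _ _ _ _ _ _ A) => //.
- exact: measurable_outcome_space hA.
- by move=> _ [w _ <-]; exact: AY.
Qed.

Lemma integral_distribution_restrict d (T : measurableType d)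
    (P : probability T R) (p : R -> R) (Y : {RV P >-> R}) (g : R -> R) :
  has_density k A p Y -> measurable_fun A g -> (forall x, 0 <= g x) ->
  (\int[P]_w (g (Y w))%:E = \int[distribution P Y]_y ((g \_ A) y)%:E)%E.
Proof.
move=> dY mg g0; have mA := measurable_outcome_space hA.
have mgA : measurable_fun setT (g \_ A).
  by apply/(measurable_restrictT _ mA); exact: mg.
rewrite ge0_integral_distribution.
- by apply: eq_integral => w _; rewrite /= patchE mem_set//; exact: dY.1.
- exact/measurable_EFinP.
- by move=> x; rewrite lee_fin patchE; case: ifP.
Qed.

(** Carries the moment bounds from the representatives [Y y] to the actual outcomes, which live on
    other probability spaces and share only the density. By symmetry one inequality suffices. *)
Lemma integral_density_law d (T : measurableType d) (P : probability T R)
    d' (T' : measurableType d') (P' : probability T' R) (p : R -> R)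
    (X : {RV P >-> R}) (Y : {RV P' >-> R}) (g : R -> R) :
  has_density k A p X -> has_density k A p Y ->
  measurable_fun A g -> (forall x, 0 <= g x) ->
  (\int[P]_w (g (X w))%:E <= \int[P']_w (g (Y w))%:E)%E.
Proof.
move=> dX dY mg g0; have mA := measurable_outcome_space hA.
have mgA : measurable_fun setT (g \_ A).
  by apply/(measurable_restrictT _ mA); exact: mg.
have gA0 x : 0 <= (g \_ A) x by rewrite patchE; case: ifP.
have -> : (\int[P]_w (g (X w))%:E = \int[P]_w ((g \_ A) (X w) * cst 1 w)%:E)%E.
  by apply: eq_integral => w _; rewrite /= mulr1 patchE mem_set//; exact: dX.1.
rewrite (integral_distribution_restrict dY mg g0).
apply: le_integral_transfer => // B mB.
have /= -> := integral_cst P (measurable_funPTI X mB) 1%:E.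
by rewrite mul1e /distribution /pushforward /= dX.2// dY.2.
Qed.

(** Only this direction is called for: it bounds the mean of a likelihood ratio from below by the
    mass of the shifted density. *)
Lemma integral_density_ge d (T : measurableType d) (P : probability T R)
    (p : R -> R) (Y : {RV P >-> R}) (g : R -> R) :
  has_density k A p Y -> (forall x, A x -> 0 <= p x) -> measurable_fun A p ->
  measurable_fun A g -> (forall x, 0 <= g x) ->
  (outcome_integral k A (fun x => (g x * p x)%R) <= \int[P]_w (g (Y w))%:E)%E.
Proof.
move=> dY p0 mp mg g0; have mA := measurable_outcome_space hA.
have mgA : measurable_fun setT (g \_ A).
  by apply/(measurable_restrictT _ mA); exact: mg.
have gA0 x : 0 <= (g \_ A) x by rewrite patchE; case: ifP.
have pA0 x : 0 <= (p \_ A) x by rewrite patchE; case: ifPn => // /set_mem /p0.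
have mpA : measurable_fun setT (p \_ A).
  by apply/(measurable_restrictT _ mA); exact: mp.
have ED := integral_distribution_restrict dY mg g0.
have mgY := measurable_comp_density dY mg.
case: k hA dY => hA' dY /=.
- have <- : (\int[@lebesgue_measure R]_x ((g \_ A) x * (p \_ A) x)%:E =
      \int[@lebesgue_measure R]_(x in A) (g x * p x)%:E)%E.
    rewrite [RHS]integral_mkcond; apply: eq_integral => x _.
    by rewrite !patchE /=; case: ifP; rewrite ?mulr0.
  rewrite ED.
  apply: (@le_integral_transfer _ _ _ _ R lebesgue_measure
    (distribution P Y) id (p \_ A) (g \_ A)) => // B mB.
  apply: (@le_trans _ _ (outcome_integral ContinuousOutcomes (A `&` B) p)); last first.
    by rewrite -dY.2//; exact: lexx.
  rewrite /= setIC [in leRHS]integral_mkcondr.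
  rewrite le_eqVlt; apply/orP; left; apply/eqP; apply: eq_integral => x _.
  by rewrite !patchE; case: ifP.
(* Discrete case: [esum] is a supremum of finite partial sums, and the sum over a finite F is the
   expectation of g (Y) restricted to the event that Y lies in F. *)
- apply: ub_ereal_sup => _ [F [finF FA] <-].
  have dYx x : A x -> P (Y @^-1` [set x]) = (p x)%:E.
    move=> Ax; rewrite dY.2//= setIidr; last by move=> _ ->.
    by rewrite esum_set1// lee_fin p0.
  have mYx x : measurable (Y @^-1` [set x]) by exact: measurable_funPTI.
  apply: (@le_trans _ _ (\int[P]_w (\sum_(x \in F) (g x * \1_(Y @^-1` [set x]) w)%:E))%E).
    rewrite ge0_integral_fsum//; last 2 first.
    + by move=> x; apply/measurable_EFinP; apply: measurable_funM => //; exact: measurable_indic.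
    + by move=> x w _; rewrite lee_fin mulr_ge0.
    rewrite le_eqVlt; apply/orP; left; apply/eqP.
    apply: eq_fsbigr => x /set_mem /FA Ax.
    under eq_integral do rewrite EFinM.
    rewrite ge0_integralZl ?lee_fin//; last by apply/measurable_EFinP; exact: measurable_indic.
    by rewrite integral_indic// setIT EFinM -dYx.
  apply: ge0_le_integral => //.
  + by move=> w _; apply: fsume_ge0 => x _; rewrite lee_fin mulr_ge0.
  + rewrite (_ : (fun _ => _) = fun w =>
        (\sum_(x <- fset_set F) (g x * \1_(Y @^-1` [set x]) w)%:E)%E).
      apply: emeasurable_sum => x.
      by apply/measurable_EFinP; apply: measurable_funM => //; exact: measurable_indic.
    by apply/funext => w; rewrite fsbig_finite.
  + by exact/measurable_EFinP.
  + move=> w _; have [YF|YF] := pselect (F (Y w)); last first.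
      rewrite fsbig1 ?lee_fin// => x Fx.
      rewrite indicE memNset ?mulr0// => /= Yx.
      by apply: YF; rewrite Yx.
    rewrite (fsbigD1 (Y w))//= fsbig1 ?adde0.
      by rewrite indicE mem_set// mulr1.
    move=> x [_ xY]; rewrite indicE memNset ?mulr0// => /= Yx.
    by apply: xY.
Qed.
End density.

Lemma integral_gt0 (R : realType) d (T : measurableType d) (P : probability T R)
    (h : T -> R) :
  measurable_fun setT h -> (forall w, 0 < h w) -> (0 < \int[P]_w (h w)%:E)%E.
Proof.
move=> mh h0; rewrite lt_neqAle integral_ge0 ?andbT; last first.
  by move=> w _; rewrite lee_fin ltW.
apply/eqP => h00.
have mEh : measurable_fun setT (EFin \o h) by exact/measurable_EFinP.
have [H _] := ae_eq_integral_abs P measurableT mEh.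
have /H [N [mN N0 sub]] : (\int[P]_w `|(EFin \o h) w| = 0)%E.
  by rewrite [RHS]h00; apply: eq_integral => w _; rewrite /= gtr0_norm.
have NT : N = setT.
  apply/seteqP; split => // w _; apply: sub => /= /(_ Logic.I) [] hw.
  by have := h0 w; rewrite hw ltxx.
have : P setT = 0%E by rewrite -NT.
by rewrite probability_setT => /eqP; rewrite onee_eq0.
Qed.

Lemma eq_outcome_integral (R : realType) k (D : set R) (h1 h2 : R -> R) :
  (forall x, D x -> h1 x = h2 x) ->
  outcome_integral k D h1 = outcome_integral k D h2.
Proof.
move=> h12; case: k => /=.
  by apply: eq_integral => x /set_mem Dx; rewrite h12.
by apply: eq_esum => x Dx; rewrite h12.
Qed.

Section score_moments.
Context (R : realType) (k : outcome_kind) (A : set R) (f : R -> R -> R).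
Hypotheses (hA : outcome_space k A) (hf : valid_link k A f)
  (hconc : strictly_log_concave A f).
Context d (T : measurableType d) (P : probability T R) (y : R) (Y : {RV P >-> R}).
Hypothesis hY : has_density k A (f ^~ y) Y.

Let g w := score f (Y w) y.

Lemma measurable_score_RV : measurable_fun setT g.
Proof.
by apply: (measurable_comp_density hA hY (g := score f ^~ y)); exact: measurable_score hf hconc y.
Qed.

(* 1 is the mass of f (.; y + h), and f (x; y + h) < f (x; y) exp (h g (x; y)) by
   strict log-concavity. *)
Lemma score_mgf_gt1 (h : R) : h != 0 -> (1 < 'E_P[fun w => expR (h * g w)])%E.
Proof.
move=> h0; rewrite unlock.
pose r x := expR (ln (f x (y + h)) - ln (f x y)).
have mr : measurable_fun A r.
  apply: measurableT_comp => //; apply: measurable_funB; apply: measurableT_comp => //;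
    exact: (link_measurable hf).
have r1 : (1%:E <= \int[P]_w (r (Y w))%:E)%E.
  rewrite -(link_mass1 hf (y + h)).
  rewrite (@eq_outcome_integral _ _ _ _ (fun x => r x * f x y)).
    apply: (integral_density_ge hA hY) => //.
    - by move=> x Ax; rewrite ltW// (link_gt0 hf).
    - exact: (link_measurable hf).
    - by move=> x; exact: expR_ge0.
  move=> x Ax; have f0 z : f x z \is Num.pos by rewrite posrE (link_gt0 hf).
  by rewrite /r expRD expRN !lnK ?f0// divfK// gt_eqF// (link_gt0 hf).
have mrY : measurable_fun setT (r \o Y).
  by apply: (measurable_comp_density hA hY (g := r)); exact: mr.
have me : measurable_fun setT (fun w => expR (h * g w)).
  by apply: measurableT_comp => //; apply: measurable_funM => //; exact: measurable_score_RV.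
have lt_re w : 0 < expR (h * g w) - r (Y w).
  rewrite subr_gt0 ltr_expR ltrBlDl.
  exact: (ln_link_lt_tangent hconc y (hY.1 w) h0).
(* The expectation may be infinite at this stage, so strictness is read off a sum of two nonnegative
   integrals, never a difference. *)
have -> : (\int[P]_w (expR (h * g w))%:E =
   \int[P]_w (r (Y w))%:E + \int[P]_w (expR (h * g w) - r (Y w))%:E)%E.
  rewrite -ge0_integralD//.
  - by apply: eq_integral => w _; rewrite -EFinD addrC subrK.
  - by move=> w _; rewrite lee_fin expR_ge0.
  - exact/measurable_EFinP.
  - by move=> w _; rewrite lee_fin ltW.
  - by apply/measurable_EFinP; exact: measurable_funB.
apply: (@lt_le_trans _ _ (1%:E + \int[P]_w (expR (h * g w) - r (Y w))%:E)%E).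
  by rewrite lteDl//; apply: integral_gt0 => //; exact: measurable_funB.
by apply: leeD2r.
Qed.

(* No differentiation under the integral sign is needed for the score to be
   centered: 1 < E exp (lam g) <= exp (lam m + 5 lam^2 K^2) for all lam <> 0
   forces the mean m to vanish and K to be positive. *)
Lemma psi2_norm_score_mgf (K : R) :
  (psi2_norm P (fun w => (g w - fine 'E_P[g]%E)%R) <= K%:E)%E ->
  0 < K /\ forall lam : R,
    ('E_P[fun w => expR (lam * g w)] <= (expR (5 * lam ^+ 2 * K ^+ 2))%:E)%E.
Proof.
move=> hK; have mg := measurable_score_RV.
set m := fine _ in hK.
pose M lam := ('E_P[fun w => expR (lam * g w)])%E.
have K0 : 0 <= K.
  rewrite -lee_fin; apply: le_trans hK; apply: le_ereal_inf_tmp => _ [t [t0 _] <-].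
  by rewrite lee_fin ltW.
(* The infimum defining the norm need not be attained; some admissible t lies below K + e, and e
   tends to 0 only after taking logarithms. *)
have hM e : 0 < e -> forall lam, (M lam <= (expR (lam * m + 5 * lam ^+ 2 * (K + e) ^+ 2))%:E)%E.
  move=> e0 lam.
  have [] := @ereal_inf_lt _ _ (K + e)%:E (le_lt_trans hK _); first by rewrite lte_fin ltrDl.
  move=> _ [t [t0 Ht] <-]; rewrite lte_fin => tK.
  apply: (le_trans (subgaussian_mgf mg t0 Ht lam)).
  rewrite lee_fin ler_expR lerD2l ler_wpM2l//; first by rewrite mulr_ge0 ?sqr_ge0.
  by rewrite ler_sqr ?nnegrE ?ltW// ltr_wpDl.
have M1 lam : lam != 0 -> (1 < M lam)%E by exact: score_mgf_gt1.
have M_fin lam : M lam \is a fin_num.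
  rewrite ge0_fin_numE; first by apply: le_lt_trans (hM 1 ltr01 lam) _; rewrite ltry.
  by rewrite /M unlock; apply: integral_ge0 => w _; rewrite lee_fin expR_ge0.
have lnM lam : lam != 0 -> 0 < ln (fine (M lam)) /\
    ln (fine (M lam)) <= lam * m + 5 * lam ^+ 2 * K ^+ 2.
  move=> l0; have F1 : 1 < fine (M lam) by rewrite -lte_fin fineK// M1.
  split; first exact: ln_gt0.
  have F0 : fine (M lam) \is Num.pos by rewrite posrE (lt_trans _ F1).
  apply/ler_addgt0Pr => e e0.
  set c := 5 * lam ^+ 2; have c0 : 0 < c by rewrite mulr_gt0// exprn_even_gt0.
  (* For q <= 1, (K + q)^2 - K^2 <= (2 K + 1) q, so this q costs at most e. *)
  pose q := Num.min 1 (e / (c * (2 * K + 1))).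
  have D0 : 0 < c * (2 * K + 1) by rewrite mulr_gt0//; lra.
  have q0 : 0 < q by rewrite lt_min ltr01 divr_gt0.
  have q1 : q <= 1 by rewrite ge_min lexx.
  have qe : c * (2 * K + 1) * q <= e.
    by rewrite mulrC -ler_pdivlMr// ge_min lexx orbT.
  have := hM q q0 lam; rewrite -(fineK (M_fin lam)) lee_fin -[X in X <= _]lnK// ler_expR.
  move/le_trans; apply; rewrite -/c -addrA lerD2l.
  have : c * (q * q) <= c * (1 * q) by rewrite ler_pM2l// ler_pM2r.
  by rewrite !expr2; nra.
have K_gt0 : 0 < K.
  rewrite lt_neqAle K0 andbT eq_sym; apply/eqP => K00.
  (* With K = 0, the choices lam = 1 and lam = -1 would give both m > 0 and m < 0. *)
  have [a1 a2] := lnM 1 (oner_neq0 _).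
  have [] := lnM (-1); first by rewrite oppr_eq0 oner_neq0.
  by move: a1 a2; rewrite K00 expr0n /=; lra.
have m0 : m = 0.
  apply/eqP; apply/negPn/negP => mn0.
  have K2 : 0 < K ^+ 2 by rewrite exprn_gt0.
  (* The minimizer of lam m + 5 lam^2 K^2, whose value - m^2 / (20 K^2) cannot be positive. *)
  have [|b1 b2] := lnM (- m / (10 * K ^+ 2)).
    by rewrite mulf_neq0 ?oppr_eq0// invr_eq0 gt_eqF// mulr_gt0.
  have := lt_le_trans b1 b2.
  have -> : - m / (10 * K ^+ 2) * m + 5 * (- m / (10 * K ^+ 2)) ^+ 2 * K ^+ 2 =
      - (m ^+ 2 / (20 * K ^+ 2)) by field; rewrite gt_eqF.
  by rewrite ltNge oppr_le0 divr_ge0 ?sqr_ge0// mulr_ge0 ?sqr_ge0.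
split=> // lam; have [->|l0] := eqVneq lam 0.
  rewrite expr0n /= mulr0 mul0r expR0 unlock.
  under eq_integral do rewrite mul0r expR0.
  by have /= -> := integral_cst P measurableT 1%:E; rewrite probability_setT mule1.
rewrite -/(M lam) -(fineK (M_fin lam)) lee_fin.
have [_] := lnM lam l0; rewrite m0 mulr0 add0r -ler_expR lnK// posrE.
by rewrite (lt_trans ltr01)// -lte_fin fineK// M1.
Qed.

(** The score and its mean are both bounded by B, so the centered score is at most 2 B and t = 4 B
    is admissible with room to spare. *)
Lemma psi2_norm_score_bounded (B : R) : 0 < B ->
  (forall x, A x -> `|score f x y| <= B) ->
  (psi2_norm P (fun w => (g w - fine 'E_P[g]%E)%R) <= (4 * B)%:E)%E.
Proof.
move=> B0 hB; have gB w : `|g w| <= B by apply: hB; exact: hY.1.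
have mg := measurable_score_RV.
have int1 (r : R) : (\int[P]_w r%:E = r%:E)%E.
  by have /= -> := integral_cst P measurableT r%:E; rewrite probability_setT mule1.
have EB : `|fine 'E_P[g]| <= B.
  have H : (`| 'E_P[g] | <= B%:E)%E.
    rewrite unlock; apply: (le_trans (le_abse_integral _ _ _)) => //.
      exact/measurable_EFinP.
    rewrite -[leRHS]int1; apply: ge0_le_integral => //.
    - by apply/measurable_EFinP; exact: measurableT_comp.
    - by move=> w _; rewrite lee_fin; exact: gB.
  by move: H; case: ('E_P[g])%E => [r| |]//=; rewrite ?normr0 ?ltW.
set m := fine _ in EB *.
apply: ereal_inf_lbound; exists (4 * B) => //; split; first by rewrite mulr_gt0.
rewrite unlock -[leRHS]int1; apply: ge0_le_integral => //.
- apply/measurable_EFinP; apply: measurableT_comp => //; apply: measurable_funM => //.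
  by apply: measurable_funX; exact: measurable_funB.
- move=> w _; rewrite lee_fin.
  have Zle : `|g w - m| <= 2 * B.
    by apply: (le_trans (ler_normB _ _)); have := gB w; lra.
  have : (g w - m) ^+ 2 / (4 * B) ^+ 2 <= 1 / 2.
    rewrite ler_pdivrMr ?exprn_gt0 ?mulr_gt0// -real_normK ?num_real//.
    have : `|g w - m| ^+ 2 <= (2 * B) ^+ 2.
      by rewrite ler_sqr ?nnegrE// mulr_ge0 ?ltW.
    have := sqr_ge0 B; rewrite !exprMn; lra.
  rewrite -ler_expR => /le_trans; apply.
  (* The inverse of 1 - 1/2 <= exp (-1/2) is exp (1/2) <= 2. *)
  have := expR_ge1Dx (- (1 / 2) : R); rewrite expRN => h.
  have E0 : 0 < expR (1 / 2 : R) := expR_gt0 _.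
  have EV : expR (1 / 2 : R) * (expR (1 / 2))^-1 = 1 by rewrite mulfV// gt_eqF.
  nra.
Qed.
End score_moments.

(** * Cuts of the comparison graph *)

Section graph.
Local Open Scope nat_scope.

(** Each pair straddling the two sets is met once on either side, oriented from U to W on the left
    and by index on the right. Values in any commutative monoid cover both edge counts and sums of
    scores. *)
Lemma sum_between (V : nmodType) n (U W : {set 'I_n}) (F : 'I_n -> 'I_n -> V) :
  [disjoint U & W]%B ->
  (\sum_(i in U) \sum_(j in W) F i j)%R =
  (\sum_(p : 'I_n * 'I_n | (p.1 < p.2)%N &&
      ((p.1 \in U) && (p.2 \in W) || (p.1 \in W) && (p.2 \in U)))
    (if p.1 \in U then F p.1 p.2 else F p.2 p.1))%R.
Proof.
move=> dUW; rewrite pair_big /=.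
rewrite (bigID (fun p : 'I_n * 'I_n => p.1 < p.2)) /= [RHS](bigID (fun p => p.1 \in U)) /=.
have notW i : i \in U -> (i \in W) = false.
  by move=> iU; have /pred0P/(_ i) /= := dUW; rewrite iU.
congr (_ + _)%R.
  apply: eq_big => [[i j]|[i j] /= /andP[/andP[-> _] _]]//=.
  by have := notW i; case: (i \in U) => [->|]//=; rewrite ?andbT ?orbF ?andbF// andbC.
rewrite (reindex_inj (h := fun p : 'I_n * 'I_n => (p.2, p.1))) /=; last first.
  by move=> [a b] [c e] [-> ->].
apply: eq_big => [[i j]|[i j] /= /andP[/andP[jU iW] _]]/=; last first.
  by case: ifP => // /notW; rewrite iW.
have := notW i; have := notW j.
have [iU _ /(_ isT)->|iU] := boolP (i \in U) => /=; first by rewrite !andbF.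
have [jU /(_ isT) _ _|jU] := boolP (j \in U) => /=; last by rewrite !andbF.
rewrite !andbT; case: (boolP (i \in W)) => //= iW; rewrite ?andbF ?andbT//.
by rewrite -leqNgt leq_eqVlt; case: eqP => //= ij; move: iU; rewrite (val_inj ij) jU.
Qed.

Context n (G : multigraph n).

Lemma edges_betweenE (U W : {set 'I_n}) : [disjoint U & W]%B ->
  edges_between G U W = \sum_(i in U) \sum_(j in W) G i j.
Proof.
move=> dUW; rewrite (@sum_between nat n U W (mult G) dUW) /edges_between.
by apply: eq_bigr => p _; case: ifP => // _; rewrite mult_sym.
Qed.

Lemma boundaryE (U : {set 'I_n}) :
  boundary G U = \sum_(i in U) \sum_(j in ~: U) G i j.
Proof. by rewrite /boundary edges_betweenE// finset.disjoints_subset finset.setCK. Qed.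

Lemma boundary_gt0 (U : {set 'I_n}) : connected_graph G ->
  U != finset.set0 -> U != [set: 'I_n]%SET -> 0 < boundary G U.
Proof.
move=> hG /finset.set0Pn[i iU] UT.
have /existsP[j jU] : [exists j, j \notin U].
  rewrite -negb_forall; apply: contraNN UT => /forallP UT.
  by apply/eqP/setP => j; rewrite UT inE.
rewrite lt0n; apply: contraNneq jU; rewrite boundaryE => /eqP.
rewrite sum_nat_eq0 => /forall_inP H.
have cl : fingraph.closed (fun a b => 0 < G a b) (mem U).
  suff clU a b : 0 < G a b -> a \in U -> b \in U.
    move=> a b /= Gab; apply/idP/idP; first exact: clU.
    by apply: clU; rewrite mult_sym.
  move=> Gab aU; apply/negPn/negP => bU; move: (H a aU); rewrite sum_nat_eq0.
  by move=> /forall_inP /(_ b); rewrite inE => /(_ bU); rewrite -leqn0 leqNgt Gab.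
by have := closed_connect cl (hG i j); rewrite iU => <-.
Qed.

Lemma boundary_edge (U : {set 'I_n}) : 0 < boundary G U ->
  exists i j, [/\ i \in U, j \notin U & 0 < G i j].
Proof.
rewrite lt0n boundaryE sum_nat_eq0 negb_forall_in => /exists_inP[i iU].
rewrite sum_nat_eq0 negb_forall_in => /exists_inP[j]; rewrite inE => jU Gij.
by exists i, j; rewrite lt0n.
Qed.

End graph.

(** * Concentration of the cut scores *)

(** Holds at every sample point, which lets the deterministic half of the argument proceed without
    any probability. *)
Definition realizable (R : realType) (A : set R) n (G : multigraph n)
    (x : 'I_n -> 'I_n -> nat -> R) : Prop :=
  forall i j t, i != j -> (t < G i j)%N -> A (x i j t) /\ x j i t = - x i j t.

(** For a realizable x this is the derivative of the log-likelihood at v in the direction of the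
    indicator of U. *)
Definition cut_score (R : realType) (f : R -> R -> R) n (G : multigraph n)
    (x : 'I_n -> 'I_n -> nat -> R) (v : 'rV[R]_n) (U : {set 'I_n}) : R :=
  \sum_(i in U) \sum_(j in ~: U) \sum_(t < G i j)
    score f (x i j t) (v 0 i - v 0 j).

(** Every cut edge occurs once, from the smaller index to the larger, since independence is stated
    for that orientation only; [cut_sign] restores the direction out of U. *)
Definition cut_edges n (G : multigraph n) (U : {set 'I_n}) :
    seq ('I_n * 'I_n * nat) :=
  [seq (p, t) | p <- enum [pred p : 'I_n * 'I_n | (p.1 < p.2)%N &&
      ((p.1 \in U) && (p.2 \in ~: U) || (p.1 \in ~: U) && (p.2 \in U))],
    t <- iota 0 (G p.1 p.2)].

Section cut_edges.
Context n (G : multigraph n) (U : {set 'I_n}).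

Lemma cut_edges_uniq : uniq (cut_edges G U).
Proof.
apply: allpairs_uniq_dep; first exact: enum_uniq.
- by move=> p _; exact: iota_uniq.
- by move=> [p t] [p' t'] _ _ /= [-> ->].
Qed.

Lemma cut_edgesP e : e \in cut_edges G U ->
  (e.1.1 < e.1.2)%N /\ (e.2 < G e.1.1 e.1.2)%N.
Proof.
case/allpairsPdep => p [t []]; rewrite mem_enum => /andP[plt _].
by rewrite mem_iota add0n => /andP[_ tG] ->.
Qed.

Lemma big_cut_edges (V : nmodType) (F : 'I_n * 'I_n * nat -> V) :
  (\sum_(e <- cut_edges G U) F e =
  \sum_(p : 'I_n * 'I_n | (p.1 < p.2)%N &&
      ((p.1 \in U) && (p.2 \in ~: U) || (p.1 \in ~: U) && (p.2 \in U)))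
    \sum_(t < G p.1 p.2) F (p, t : nat))%R.
Proof.
rewrite big_allpairs_dep /= big_enum /=; apply: eq_bigr => p _.
by rewrite -[X in iota _ X]subn0 -/(index_iota _ _) big_mkord.
Qed.

Lemma size_cut_edges : size (cut_edges G U) = boundary G U.
Proof.
rewrite -sum1_size big_cut_edges; apply: eq_bigr => p _.
by rewrite sum_nat_const card_ord muln1.
Qed.

End cut_edges.

Section cut_score_edges.
Context (R : realType) (k : outcome_kind) (A : set R) (f : R -> R -> R).
Hypotheses (hA : outcome_space k A) (hf : valid_link k A f)
  (hconc : strictly_log_concave A f).
Context n (G : multigraph n).

Definition cut_sign (U : {set 'I_n}) (i : 'I_n) : R := if i \in U then 1 else -1.

Lemma cut_scoreE (x : 'I_n -> 'I_n -> nat -> R) (v : 'rV[R]_n) (U : {set 'I_n}) :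
  realizable A G x ->
  cut_score f G x v U =
  \sum_(e <- cut_edges G U)
    cut_sign U e.1.1 * score f (x e.1.1 e.1.2 e.2) (v 0 e.1.1 - v 0 e.1.2).
Proof.
move=> hx; rewrite big_cut_edges /cut_score.
rewrite (@sum_between R n U (~: U)
  (fun i j => \sum_(t < G i j) score f (x i j t) (v 0 i - v 0 j))); last first.
  by rewrite finset.disjoints_subset finset.setCK.
apply: eq_bigr => [[i j]] /= /andP[ij _]; rewrite /cut_sign.
case: ifP => _; first by apply: eq_bigr => t _; rewrite mul1r.
rewrite [in LHS](mult_sym G j i); apply: eq_bigr => t _.
have ij' : i != j by rewrite neq_ltn ij.
have [Ax ->] := hx i j t ij' (ltn_ord t).
by rewrite -opprB (score_opp hA hf hconc)// mulN1r.
Qed.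

End cut_score_edges.

Section concentration.
Context (R : realType) (k : outcome_kind) (A : set R) (f : R -> R -> R).
Hypotheses (hA : outcome_space k A) (hf : valid_link k A f)
  (hconc : strictly_log_concave A f).
Context n (G : multigraph n) (u : 'rV[R]_n).
Context d (T : measurableType d) (P : probability T R)
  (X : 'I_n -> 'I_n -> nat -> {RV P >-> R}).
Hypothesis hX : comparison_outcomes k A f G u X.

Lemma comparison_outcomes_realizable w : realizable A G (fun i j t => X i j t w).
Proof.
case: hX => _ dens anti i j t ij tG.
split; last exact: anti.
case: (ltngtP i j) => [lij|lji|/val_inj eij].
- by have [+ _] := dens i j t lij tG; apply.
- have tG' : (t < G j i)%N by rewrite mult_sym.
  rewrite anti//; last by rewrite eq_sym.
  by case: hA => symA _; apply: symA; have [+ _] := dens j i t lji tG'; apply.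
- by rewrite eij eqxx in ij.
Qed.

Variables (M K : R).
Context dY (TY : measurableType dY) (PY : probability TY R) (Y : R -> {RV PY >-> R}).
Hypotheses (hY : forall y, has_density k A (f ^~ y) (Y y))
  (hmgf : forall y lam : R, `|y| <= M ->
    ('E_PY[fun w => expR (lam * score f (Y y w) y)]
       <= (expR (5 * lam ^+ 2 * K ^+ 2))%:E)%E)
  (uM : forall i j, `|u 0 i - u 0 j| <= M).

Let S U w := cut_score f G (fun i j t => X i j t w) u U.

Lemma measurable_cut_score U : measurable_fun setT (S U).
Proof.
rewrite (_ : S U = fun w => \sum_(e <- cut_edges G U) cut_sign R U e.1.1 *
    score f (X e.1.1 e.1.2 e.2 w) (u 0 e.1.1 - u 0 e.1.2)); last first.
  by apply/funext => w; rewrite /S (cut_scoreE hA hf hconc)//; exact: comparison_outcomes_realizable.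
have := @cut_edgesP n G U; elim: (cut_edges G U) => [|e L IH] HL.
  by under eq_fun do rewrite big_nil; exact: measurable_cst.
under eq_fun do rewrite big_cons; apply: measurable_funD; last first.
  by apply: IH => e' e'L; apply: HL; rewrite inE e'L orbT.
apply: measurable_funM => //.
have [e1 e2] := HL e (mem_head _ _); case: hX => _ dens _.
apply: (measurable_comp_density hA (dens _ _ _ e1 e2)
  (g := score f ^~ (u 0 e.1.1 - u 0 e.1.2))).
exact: measurable_score hf hconc _.
Qed.

(** Independence factorizes exp (lam S_U) over the cut edges. The sign of an edge disappears because
    the bound depends on lam only through lam^2. The factors are extended by 0 outside A, where the
    score need not be measurable. *)
Lemma cut_score_mgf U (lam : R) :
  (\int[P]_w (expR (lam * S U w))%:E
    <= (expR (5 * lam ^+ 2 * K ^+ 2 * (boundary G U)%:R))%:E)%E.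
Proof.
case: (hX) => ind dens _.
pose Xe (e : 'I_n * 'I_n * nat) := X e.1.1 e.1.2 e.2.
pose y (e : 'I_n * 'I_n * nat) := u 0 e.1.1 - u 0 e.1.2.
pose g (e : 'I_n * 'I_n * nat) x := expR (lam * cut_sign R U e.1.1 * score f x (y e)).
pose b := expR (5 * lam ^+ 2 * K ^+ 2).
have mg e : measurable_fun A (g e).
  apply: measurableT_comp => //; apply: measurable_funM => //.
  exact: (measurable_score hf hconc).
have mA := measurable_outcome_space hA.
have mgA e : measurable_fun setT (g e \_ A).
  by apply/(measurable_restrictT _ mA); exact: mg.
have Ee : expR (5 * lam ^+ 2 * K ^+ 2 * (boundary G U)%:R) =
    \prod_(e <- cut_edges G U) b.
  by rewrite big_const_seq count_predT size_cut_edges iter_mulr_1 /b -expRM_natr.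
have ES w : expR (lam * S U w) = \prod_(e <- cut_edges G U) (g e \_ A) (Xe e w).
  rewrite /S (cut_scoreE hA hf hconc); last exact: comparison_outcomes_realizable.
  rewrite mulr_sumr expR_sum; apply: eq_big_seq => e /cut_edgesP[e1 e2].
  rewrite patchE mem_set; last by have [+ _] := dens _ _ _ e1 e2; apply.
  by rewrite /g mulrA.
rewrite Ee; under eq_integral do rewrite ES.
apply: (independent_prod_le (X := Xe) ind (phi := fun e => g e \_ A) (b := fun=> b)) => //.
- by move=> e x; rewrite patchE; case: ifP => // _; exact: expR_ge0.
- by move=> _; exact: expR_ge0.
- exact: cut_edges_uniq.
- by move=> e /cut_edgesP.
move=> e /cut_edgesP[e1 e2]; have de := dens _ _ _ e1 e2.
have -> : (\int[P]_w ((g e \_ A) (Xe e w))%:E = \int[P]_w (g e (Xe e w))%:E)%E.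
  by apply: eq_integral => w _; rewrite patchE mem_set//; exact: de.1.
apply: (le_trans (integral_density_law hA de (hY (y e)) (mg e) _)).
  by move=> x; exact: expR_ge0.
have := hmgf (lam * cut_sign R U e.1.1) (uM e.1.1 e.1.2).
rewrite unlock /g /b => /le_trans; apply; rewrite lee_fin ler_expR.
by rewrite /cut_sign; case: ifP => _; rewrite ?mulr1 ?mulrN1 ?sqrrN.
Qed.
End concentration.

Lemma sum_expr_card (R : comNzRingType) (T : finType) (x : R) :
  \sum_(U : {set T}) x ^+ #|U| = (1 + x) ^+ #|T|.
Proof.
have -> : (1 + x) ^+ #|T| = \prod_(i : T) \sum_(b : bool) (if b then x else 1).
  rewrite (eq_bigr (fun=> 1 + x)); first by rewrite prodr_const cardT.
  by move=> i _; rewrite big_bool addrC.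
rewrite bigA_distr_bigA /=.
rewrite (reindex (fun U : {set T} => [ffun i => i \in U])) /=; last first.
  exists (fun g : {ffun T -> bool} => [set i | g i]%SET).
    by move=> U _; apply/setP => i; rewrite inE ffunE.
  by move=> g _; apply/ffunP => i; rewrite ffunE inE.
apply: eq_bigr => U _; rewrite -prodr_const [RHS](bigID (mem U)) /=.
rewrite [X in _ * X]big1 ?mulr1.
  by apply: eq_bigr => i iU; rewrite ffunE iU.
by move=> i /negbTE iU; rewrite ffunE iU.
Qed.

(** With x = n^-5, x^min is at most x^|U| + x^|U^c|. Either half sums to (1 + x)^n - 1 <= exp (n x)
    - 1 <= 2 n x, since n x <= 1/2, and the total 4 n^-4 is at most n^-2 for n >= 2. *)
Lemma sum_expr_minn_card (R : realType) n : (1 < n)%N ->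
  \sum_(U : {set 'I_n} | (U != finset.set0) && (U != [set: 'I_n]%SET))
    (n%:R ^- 5) ^+ minn #|U| #|~: U| <= n%:R ^- 2 :> R.
Proof.
move=> n1; have n2 : 2 <= n%:R :> R by rewrite ler_nat.
have n0 : 0 < n%:R :> R by rewrite ltr0n ltnW.
set x := n%:R ^- 5; have x0 : 0 < x by rewrite invr_gt0 exprn_gt0.
have xE k : 0 <= x ^+ k by rewrite exprn_ge0// ltW.
have half : \sum_(U : {set 'I_n} | U != finset.set0) x ^+ #|U| <= 2 * n%:R * x.
  have := sum_expr_card 'I_n x; rewrite (bigD1 finset.set0) //= cards0 expr0 card_ord => E.
  have -> : \sum_(U : {set 'I_n} | U != finset.set0) x ^+ #|U| = (1 + x) ^+ n - 1.
    by rewrite -E addrAC subrr add0r.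
  have h1 : (1 + x) ^+ n <= expR (n%:R * x).
    rewrite expRM_natl; apply: lerXn2r; rewrite ?nnegrE ?expR_ge0 ?expR_ge1Dx//.
    by rewrite addr_ge0// ltW.
  have y2 : n%:R * x <= 1 / 2.
    rewrite /x (exprSr _ 4) invfM mulrCA mulfV ?gt_eqF// mulr1 div1r lef_pV2 ?posrE ?exprn_gt0//.
    rewrite (le_trans n2)// -[leLHS]expr1 ler_weXn2l//; lra.
  have y0 : 0 <= n%:R * x by rewrite mulr_ge0 ?ltW.
  set y := n%:R * x in h1 y2 y0 *.
  have e0 : 0 < expR y := expR_gt0 _.
  have eV : expR y * expR (- y) = 1 by rewrite -expRD subrr expR0.
  have e1 := expR_ge1Dx (- y).
  have e2 : expR y * (1 - y) <= expR y * expR (- y) by rewrite ler_pM2l.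
  rewrite eV in e2.
  rewrite -mulrA -/y; nra.
apply: (@le_trans _ _ (2 * n%:R * x + 2 * n%:R * x)).
  have halfC : \sum_(U : {set 'I_n} | U != [set: 'I_n]%SET) x ^+ #|~: U| <= 2 * n%:R * x.
    rewrite (reindex_inj (@finset.setC_inj _)) /=; apply: le_trans half.
    rewrite le_eqVlt; apply/orP; left; apply/eqP; apply: eq_big => [U|U _].
      by rewrite -finset.setC0 (inj_eq (@finset.setC_inj _)).
    by rewrite finset.setCK.
  apply: le_trans (lerD half halfC).
  rewrite [X in _ <= X + _]big_mkcond [X in _ <= _ + X]big_mkcond -big_split big_mkcond /=.
  apply: ler_sum => U _; have [U0|U0] := boolP (U != finset.set0); last first.
    by rewrite add0r; case: ifP.
  have [UT|UT] := boolP (U != [set: 'I_n]%SET) => /=; last by rewrite addr0.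
  by rewrite /minn; case: ifP => _; rewrite ?lerDl ?lerDr.
rewrite /x; have -> : 2 * n%:R * n%:R ^- 5 + 2 * n%:R * n%:R ^- 5 = 4 / n%:R ^+ 2 * n%:R ^- 2 :> R.
  by field; rewrite gt_eqF.
rewrite ger_pMl ?invr_gt0 ?exprn_gt0// ler_pdivrMr ?exprn_gt0// mul1r.
rewrite (_ : 4 = 2 ^+ 2 :> R); last by rewrite -natrX.
by rewrite ler_sqr ?nnegrE // ltW.
Qed.

Section union_bound.
Context (R : realType) (k : outcome_kind) (A : set R) (f : R -> R -> R).
Hypotheses (hA : outcome_space k A) (hf : valid_link k A f)
  (hconc : strictly_log_concave A f).
Context n (G : multigraph n) (u : 'rV[R]_n).
Context d (T : measurableType d) (P : probability T R)
  (X : 'I_n -> 'I_n -> nat -> {RV P >-> R}).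
Hypothesis hX : comparison_outcomes k A f G u X.
Variables (M K : R).
Context dY (TY : measurableType dY) (PY : probability TY R) (Y : R -> {RV PY >-> R}).
Hypotheses (hY : forall y, has_density k A (f ^~ y) (Y y))
  (hmgf : forall y lam : R, `|y| <= M ->
    ('E_PY[fun w => expR (lam * score f (Y y w) y)]
       <= (expR (5 * lam ^+ 2 * K ^+ 2))%:E)%E)
  (uM : forall i j, `|u 0 i - u 0 j| <= M).
Hypotheses (K_gt0 : 0 < K) (hG : connected_graph G) (n_gt1 : (1 < n)%N).

Let cut_threshold (U : {set 'I_n}) : R :=
  10 * K * Num.sqrt ((boundary G U * minn #|U| #|~: U|)%:R * ln n%:R).

Let S U w := cut_score f G (fun i j t => X i j t w) u U.

Let proper (U : {set 'I_n}) := (U != finset.set0) && (U != [set: 'I_n]%SET).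

(* Minimizes 5 lam^2 K^2 |bd U| - lam * cut_threshold U. *)
Let lam (U : {set 'I_n}) :=
  Num.sqrt ((minn #|U| #|~: U|)%:R * ln n%:R / (boundary G U)%:R) / K.

(** At this [lam] the threshold contributes -10 m log n to the exponent and the moment bound +5 m
    log n, with m the smaller side of the cut. *)
Let cut_tail U : proper U ->
  (\int[P]_w (expR (lam U * (S U w - cut_threshold U)))%:E
     <= ((n%:R ^- 5) ^+ minn #|U| #|~: U|)%:E)%E.
Proof.
move=> /andP[U0 UT].
have N0 : 0 < (boundary G U)%:R :> R by rewrite ltr0n boundary_gt0.
set N := (boundary G U)%:R in N0 *; set m := minn _ _.
have n0 : 0 < n%:R :> R by rewrite ltr0n ltnW.
have L0 : 0 <= m%:R * ln n%:R :> R by rewrite mulr_ge0// ln_ge0// ler1n ltnW.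
have mS := measurable_cut_score hA hf hconc hX U.
have e1 : lam U * cut_threshold U = 10 * (m%:R * ln n%:R).
  rewrite /lam /cut_threshold -/m -/N natrM -/N -[N * m%:R * _]mulrA.
  rewrite [N * _]mulrC (sqrtrM N^-1 L0) (sqrtrM N L0).
  have s1 : Num.sqrt N^-1 * Num.sqrt N = 1.
    by rewrite -sqrtrM ?invr_ge0 ?(ltW N0)// mulVf ?sqrtr1// gt_eqF.
  have s2 := sqr_sqrtr L0; rewrite expr2 in s2.
  transitivity (10 * (Num.sqrt (m%:R * ln n%:R) * Num.sqrt (m%:R * ln n%:R)) *
    (Num.sqrt N^-1 * Num.sqrt N)); last by rewrite s1 s2 mulr1.
  by move: (Num.sqrt _) (Num.sqrt _) (Num.sqrt _) => a b c; field; rewrite gt_eqF.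
have e2 : 5 * lam U ^+ 2 * K ^+ 2 * N = 5 * (m%:R * ln n%:R).
  rewrite /lam -/m -/N exprMn sqr_sqrtr; last by rewrite divr_ge0// ltW.
  by field; rewrite !gt_eqF.
under eq_integral do rewrite mulrBr expRD EFinM muleC.
rewrite ge0_integralZl ?lee_fin ?expR_ge0//; last first.
  by apply/measurable_EFinP; apply: measurableT_comp => //; exact: measurable_funM.
have := cut_score_mgf hA hf hconc hX hY hmgf uM U (lam U).
rewrite -/N e2 e1 => H.
apply: (@le_trans _ _ ((expR (- (10 * (m%:R * ln n%:R))))%:E *
    (expR (5 * (m%:R * ln n%:R)))%:E)%E).
  by apply: lee_wpmul2l => //; rewrite lee_fin expR_ge0.
rewrite -EFinM -expRD lee_fin le_eqVlt; apply/orP; left; apply/eqP.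
have -> : - (10 * (m%:R * ln n%:R)) + 5 * (m%:R * ln n%:R) =
    m%:R * (5%:R * (- ln n%:R)) :> R by ring.
by rewrite !expRM_natl expRN lnK ?posrE// -[X in _ = X ^+ m]exprVn.
Qed.

Lemma cut_score_concentration : exists E : set T,
  [/\ measurable E, ((1 - n%:R ^- 2)%:E <= P E)%E &
    forall w, E w -> forall U, U != finset.set0 -> U != [set: 'I_n]%SET ->
      S U w <= cut_threshold U].
Proof.
pose E := \bigcap_(U in [set U | proper U]) [set w | S U w <= cut_threshold U].
have mS U := measurable_cut_score hA hf hconc hX U.
have mE : measurable E.
  apply: fin_bigcap_measurable; first exact: finite_finset.
  move=> U _; rewrite (_ : [set _ | _] = S U @^-1` `]-oo, cut_threshold U]).
    by rewrite -[X in measurable X]setTI; exact: mS.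
  by apply/seteqP; split => w /=; rewrite in_itv.
exists E; split => //; last first.
  by move=> w Ew U U0 UT; apply: Ew; rewrite /= /proper U0.
have : (P (~` E) <= (n%:R ^- 2)%:E)%E.
  have m1 U : measurable_fun setT (fun w => (expR (lam U * (S U w - cut_threshold U)))%:E).
    apply/measurable_EFinP; apply: measurableT_comp => //; apply: measurable_funM => //.
    by apply: measurable_funB => //; exact: mS.
  (* Markov and the union bound in one stroke: where some cut exceeds its threshold, its exponential
     is at least 1, so the sum dominates the indicator of the bad event. *)
  apply: (@le_trans _ _ (\int[P]_w (\sum_(U <- enum proper)
      (expR (lam U * (S U w - cut_threshold U)))%:E))%E).
    have mEc : measurable (~` E) by exact: measurableC.
    rewrite -[X in P X]setIT -integral_indic//; apply: ge0_le_integral => //.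
    - by apply/measurable_EFinP; exact: measurable_indic.
    - exact: emeasurable_sum.
    - move=> w _; rewrite indicE; have [|nEw] := boolP (w \in ~` E); last first.
        by apply: sume_ge0 => U _; rewrite lee_fin expR_ge0.
      move=> /set_mem /existsNP[U] /not_implyP[/= pU /negP]; rewrite -ltNge => SU.
      rewrite big_enum (bigD1 U)//= -[leLHS]adde0; apply: leeD.
        rewrite lee_fin -expR0 ler_expR mulr_ge0//; last by rewrite subr_ge0 ltW.
        by rewrite /lam divr_ge0 ?sqrtr_ge0 ?ltW.
      by apply: sume_ge0 => V _; rewrite lee_fin expR_ge0.
  rewrite ge0_integral_sum//.
  rewrite big_enum /=.
  apply: (@le_trans _ _ (\sum_(U | proper U) ((n%:R ^- 5) ^+ minn #|U| #|~: U|)%:E)%E).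
    by apply: lee_sum => U; exact: cut_tail.
  by rewrite sumEFin lee_fin; exact: sum_expr_minn_card.
have PE : P E = (fine (P E))%:E by rewrite fineK// fin_num_measure.
rewrite probability_setC// PE; move: (fine (P E)) => r.
have -> : (1 - r%:E)%E = (1 - r)%:E by rewrite EFinB.
by rewrite !lee_fin; lra.
Qed.
End union_bound.

(** * The maximum likelihood estimator *)

Lemma continuous_sum_seq (R : realType) (V : topologicalType) (I : eqType)
    (r : seq I) (Q : pred I) (F : I -> V -> R) :
  (forall i, i \in r -> Q i -> continuous (F i)) ->
  continuous (fun v => \sum_(i <- r | Q i) F i v).
Proof.
elim: r => [|i r IH] HF.
  by under eq_fun do rewrite big_nil; exact: cst_continuous.
have HF' j : j \in r -> Q j -> continuous (F j).
  by move=> jr; apply: HF; rewrite inE jr orbT.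
case Qi : (Q i); under eq_fun do rewrite big_cons Qi; last exact: IH.
move=> v; apply: cvgD; last exact: IH.
by apply: HF => //; exact: mem_head.
Qed.

Section mle_existence.
Context (R : realType) (k : outcome_kind) (A : set R) (f : R -> R -> R).
Hypotheses (hf : valid_link k A f) (hconc : strictly_log_concave A f).
Context n (G : multigraph n) (x : 'I_n -> 'I_n -> nat -> R).
Hypotheses (hx : realizable A G x) (n_gt0 : (0 < n)%N).

(** Both orientations are listed, as in [loglik]: an edge with a positive outcome then also appears
    reversed, with a negative one. *)
Let E : seq ('I_n * 'I_n * nat) :=
  [seq (p, t) | p <- enum [pred p : 'I_n * 'I_n | p.1 != p.2],
    t <- iota 0 (G p.1 p.2)].

Let mem_E i j t : ((i, j, t) \in E) = (i != j) && (t < G i j)%N.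
Proof.
apply/allpairsPdep/andP => [[[i1 j1] [t1 [pE tE [-> -> ->]]]]|[ij tG]].
  by move: pE tE; rewrite mem_enum mem_iota.
by exists (i, j), t; rewrite mem_enum mem_iota.
Qed.

Let l (e : 'I_n * 'I_n * nat) y := ln (f (x e.1.1 e.1.2 e.2) y).
Let W (v : 'rV[R]_n) := \sum_(e <- E) l e (v 0 e.1.1 - v 0 e.1.2).

Let loglikW v : loglik f G x v = 2^-1 * W v.
Proof.
rewrite /loglik /W big_allpairs_dep big_enum pair_big_dep /=; congr (_ * _).
apply: eq_bigr => p _.
by rewrite -[X in iota _ X]subn0 -/(index_iota _ _) big_mkord.
Qed.

Let EA e : e \in E -> A (x e.1.1 e.1.2 e.2).
Proof. by case: e => [[i j] t]; rewrite mem_E => /andP[ij tG]; case: (hx ij tG). Qed.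

Lemma continuous_loglik : continuous (loglik f G x).
Proof.
rewrite (_ : loglik f G x = fun v => 2^-1 * W v); last exact/funext/loglikW.
move=> v; apply: (@continuousM _ _ (cst (2^-1 : R)) W v); first exact: cst_continuous.
suff cW : continuous W by exact: cW.
rewrite /W; apply: continuous_sum_seq.
move=> e /EA Ae _ w.
have ce y : {for y, continuous (l e)}.
  apply: differentiable_continuous; apply/derivable1_diffP.
  by have [] := hconc y Ae.
apply: (@continuous_comp _ _ _ (fun v : 'rV[R]_n => v 0 e.1.1 - v 0 e.1.2) (l e)).
  apply: (@continuousB _ _ _ (fun v : 'rV[R]_n => v 0 e.1.1)
    (fun v : 'rV[R]_n => v 0 e.1.2)); exact: coord_continuous.
exact: ce.
Qed.

Let l_bounded : exists B : 'I_n * 'I_n * nat -> R,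
  forall e, 0 <= B e /\ (e \in E -> forall y, l e y <= B e).
Proof.
suff H e : exists b : R, 0 <= b /\ (e \in E -> forall y, l e y <= b).
  by have [B HB] := choice H; exists B.
have [/EA Ae|nE] := boolP (e \in E); last by exists 0; split.
have [b hb] := link_bounded hf Ae; exists `|ln b|; split => // _ y.
apply: le_trans (ler_norm _); have f0 := link_gt0 hf y Ae.
have fb : f (x e.1.1 e.1.2 e.2) y <= b by apply: hb; exists y.
by rewrite /l ler_ln ?posrE// (lt_le_trans f0).
Qed.

Let l_small (c : R) : exists D : 'I_n * 'I_n * nat -> R,
  forall e, 0 <= D e /\ (e \in E -> x e.1.1 e.1.2 e.2 < 0 ->
    forall y, D e <= y -> l e y < c).
Proof.
suff H e : exists b : R, 0 <= b /\ (e \in E -> x e.1.1 e.1.2 e.2 < 0 ->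
    forall y, b <= y -> l e y < c).
  by have [B HB] := choice H; exists B.
have [eE|nE] := boolP (e \in E); last by exists 0; split.
have [x0|x0] := ltP (x e.1.1 e.1.2 e.2) 0; last by exists 0; split.
have lim0 := link_lim0 hf (EA eE) x0.
have : \forall y \near +oo, f (x e.1.1 e.1.2 e.2) y < expR c.
  exact: (cvgr_lt _ lim0 _ (expR_gt0 c)).
move=> [b [_ hb]]; exists (`|b| + 1); split; first by rewrite addr_ge0.
move=> _ _ y by_; have f0 := link_gt0 hf y (EA eE).
rewrite -ltr_expR /l lnK ?posrE//; apply: hb.
by apply: lt_le_trans by_; rewrite (le_lt_trans (ler_norm b))// ltrDl.
Qed.

(** Superlevel sets are bounded. If i beats j, a large v_j - v_i makes the reversed term so negative
    that the likelihood falls below its value at 0. Strong connectivity joins any two vertices by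
    such edges, so all coordinates stay within n times one gap of each other, and a compact box
    contains every competitor. *)
Lemma mle_exists : strongly_connected G x -> exists v, is_mle f G x v.
Proof.
move=> sc; have [B HB] := l_bounded.
pose BT := \sum_(e <- E) B e.
(* Once a term is below this level, the upper bounds on all the others, at most [BT] in total, leave
   [W] below [W 0]. *)
have [D HD] := l_small (W 0 - BT).
pose D' := \sum_(e <- E) D e.
have D'0 : 0 <= D' by apply: sumr_ge0 => e _; case: (HD e).
have DD' e : e \in E -> D e <= D'.
  move=> eE; rewrite /D' (big_rem e)//= lerDl; apply: sumr_ge0 => e' _.
  by case: (HD e').
have step v i j t : W 0 <= W v -> (i, j, t) \in E -> 0 < x i j t -> v 0 j - v 0 i <= D'.
  move=> Wv; rewrite mem_E => /andP[ij tG] x0; rewrite leNgt; apply/negP => gap.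
  have eE : (j, i, t) \in E by rewrite mem_E eq_sym ij mult_sym.
  have xn : x j i t < 0 by have [_ ->] := hx ij tG; rewrite oppr_lt0.
  have le := (HD (j, i, t)).2 eE xn (v 0 j - v 0 i) (le_trans (DD' _ eE) (ltW gap)).
  suff : W v < W 0 by rewrite ltNge Wv.
  rewrite /W (big_rem _ eE)/= -ltrBrDr.
  apply: (lt_le_trans le); rewrite lerD2l lerN2 /BT (big_rem _ eE) /=.
  apply: (@le_trans _ _ (\sum_(e <- rem (j, i, t) E) B e)).
    rewrite big_seq [leRHS]big_seq; apply: ler_sum => e /mem_rem eE'.
    exact: (HB e).2.
  by rewrite lerDr; case: (HB (j, i, t)).
pose L := n%:R * D'.
have L0 : 0 <= L by rewrite mulr_ge0.
have range v a b : W 0 <= W v -> v 0 b - v 0 a <= L.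
  move=> Wv; pose e := fun i j => v 0 j - v 0 i <= D'.
  have cab : connect e a b.
    pose V1 := [set j | connect e a j]%SET.
    suff : V1 == [set: 'I_n]%SET by move=> /eqP /setP /(_ b); rewrite !inE.
    apply/negPn/negP => VT.
    have V10 : V1 != finset.set0 by apply/finset.set0Pn; exists a; rewrite inE connect0.
    have V1T : V1 \proper [set: 'I_n]%SET by rewrite finset.properEneq VT finset.subsetT.
    have [i [j [t [iV jV tG x0]]]] := sc V1 V10 V1T.
    have ij : i != j by apply: contraNneq jV => <-.
    move: jV; rewrite !inE in iV *; move/negP; apply.
    apply: connect_trans iV (connect1 _).
    by apply: (step v i j t) => //; rewrite mem_E ij.
  move: cab => /connectP[p0 /shortenP[p pth up _] ->].
  have : v 0 (last a p) - v 0 a <= (size p)%:R * D'.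
    elim: p a pth {up} => [|c p IH] a /=; first by rewrite subrr mul0r.
    move=> /andP[ac /IH]; rewrite /e in ac; rewrite -natr1 mulrDl mul1r.
    by move: ac; lra.
  move/le_trans; apply; rewrite ler_wpM2r// ler_nat.
  by have := max_card (mem (a :: p)); rewrite (card_uniqP up) card_ord; exact: ltnW.
(* The coordinate of vertex 1 is pinned to 0, so every point of the box is normalized. *)
pose S (i : 'I_n) : set R := if val i == 0%N then [set 0] else `[- L, L]%classic.
pose box := [set v : 'rV[R]_n | forall i, S i (v ord0 i)].
have cbox : compact box.
  apply: rV_compact => i; rewrite /S; case: ifP => _; last exact: segment_compact.
  exact: compact_set1.
have box_norm v : box v -> normalized v.
  by move=> bv i i0; have := bv i; rewrite /S i0.
have boxP v : normalized v -> W 0 <= W v -> box v.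
  move=> nv Wv i; rewrite /S; case: eqP => [/nv//|_].
  have v0 : v 0 (Ordinal n_gt0) = 0 by apply: nv.
  have := range v (Ordinal n_gt0) i Wv; have := range v i (Ordinal n_gt0) Wv.
  rewrite v0 sub0r subr0 => h1 h2 /=; rewrite in_itv /= h2 andbT; lra.
have box0 : box 0.
  move=> i; rewrite mxE /S; case: ifP => //= _.
  by rewrite in_itv /= L0 oppr_le0 L0.
have [c cb cmax] : exists2 c, c \in box &
    forall t, t \in box -> loglik f G x t <= loglik f G x c.
  apply: compact_EVT_max => //; first by exists 0.
  exact/continuous_subspaceT/continuous_loglik.
exists c; split; first by apply: box_norm; exact: set_mem.
move=> v nv; have [Wv|Wv] := leP (W 0) (W v).
  by apply: cmax; apply: mem_set; exact: boxP.
apply: (@le_trans _ _ (loglik f G x 0)); last by apply: cmax; exact: mem_set.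
by rewrite !loglikW ler_pM2l ?invr_gt0// ltW.
Qed.

End mle_existence.

Section mle_score.
Context (R : realType) (k : outcome_kind) (A : set R) (f : R -> R -> R).
Hypotheses (hA : outcome_space k A) (hf : valid_link k A f)
  (hconc : strictly_log_concave A f).
Context n (G : multigraph n) (x : 'I_n -> 'I_n -> nat -> R).
Hypothesis hx : realizable A G x.

Lemma ln_link_ge_tangent (y z h : R) : A y ->
  h * score f y (z + h) <= ln (f y (z + h)) - ln (f y z).
Proof.
move=> Ay; have [->|h0] := eqVneq h 0; first by rewrite mul0r addr0 subrr.
have := @ln_link_lt_tangent _ _ _ hconc y (z + h) (- h) Ay.
rewrite oppr_eq0 => /(_ h0); rewrite addrK; lra.
Qed.

Let c (v : 'rV[R]_n) (U : {set 'I_n}) (s : R) (i j : 'I_n) : R :=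
  if i != j then \sum_(t < G i j)
    score f (x i j t) (v 0 i - v 0 j - s * ((i \in U)%:R - (j \in U)%:R)) else 0.

Let c_anti v U s i j : c v U s j i = - c v U s i j.
Proof.
rewrite /c eq_sym; case: ifP => [ij|_]; last by rewrite oppr0.
rewrite mult_sym -sumrN; apply: eq_bigr => t _.
have [Ax ->] := hx ij (ltn_ord t).
by rewrite -(score_opp hA hf hconc)//; congr score; lra.
Qed.

Let cut_s (v : 'rV[R]_n) (U : {set 'I_n}) (s : R) : R :=
  \sum_(i in U) \sum_(j in ~: U) \sum_(t < G i j)
  score f (x i j t) (v 0 i - v 0 j - s).

(** The weight vanishes off the cut, and antisymmetry makes the two orientations of a cut edge
    contribute equally, hence the factor 2. *)
Let sum_c v (U : {set 'I_n}) s :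
  \sum_i \sum_j ((i \in U)%:R - (j \in U)%:R) * c v U s i j = cut_s v U s *+ 2.
Proof.
have E : cut_s v U s = \sum_i \sum_j ((i \in U)%:R * (1 - (j \in U)%:R)) * c v U s i j.
  rewrite /cut_s big_mkcond; apply: eq_bigr => i _.
  have [iU|iU] := boolP (i \in U); last by rewrite big1 // => j _; rewrite !mul0r.
  rewrite big_mkcond; apply: eq_bigr => j _; rewrite inE.
  have [jU|jU] := boolP (j \in U) => /=; first by rewrite subrr mulr0 mul0r.
  have ij : i != j by apply: contraNneq jU => <-.
  rewrite subr0 !mul1r /c ij iU (negbTE jU) subr0.
  by apply: eq_bigr => t _; rewrite mulr1.
have E' : cut_s v U s = - \sum_i \sum_j ((j \in U)%:R * (1 - (i \in U)%:R)) * c v U s i j.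
  rewrite E exchange_big -sumrN /=; apply: eq_bigr => i _; rewrite -sumrN.
  by apply: eq_bigr => j _; rewrite c_anti mulrN.
rewrite mulr2n [X in X + _]E E' -sumrB; apply: eq_bigr => i _.
by rewrite -sumrB; apply: eq_bigr => j _; rewrite -mulrBl; congr (_ * _); ring.
Qed.

(* Lowering v by s on U, then translating to stay normalized, cannot increase the
   likelihood; concavity bounds the change by the scores at the lowered point. *)
Let cut_s_ge0 v U s : is_mle f G x v -> 0 < s -> 0 <= cut_s v U s.
Proof.
move=> [nv maxv] s0.
(* Indicator that vertex 1 lies in U, written as a sum so that n = 0 needs no separate case. Adding
   s * o restores normalization and leaves all differences unchanged. *)
pose o : R := \sum_(i < n | val i == 0%N) (i \in U)%:R.
pose v' : 'rV[R]_n := \row_i (v 0 i - s * (i \in U)%:R + s * o).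
have nv' : normalized v'.
  move=> i i0; rewrite mxE (nv i i0) sub0r /o (big_pred1 i) ?addNr//.
  by move=> j; rewrite /= -i0.
have := maxv v' nv'; rewrite /loglik ler_pM2l ?invr_gt0// => H.
have : \sum_i \sum_j - s * (((i \in U)%:R - (j \in U)%:R) * c v U s i j) <= 0.
  rewrite -subr_le0 in H; apply: le_trans H.
  rewrite -sumrB; apply: ler_sum => i _.
  rewrite -sumrB [leRHS]big_mkcond; apply: ler_sum => j _.
  rewrite /c; case: ifP => ij; last by rewrite !mulr0.
  rewrite -sumrB !mulr_sumr; apply: ler_sum => t _.
  have [Ax _] := hx ij (ltn_ord t).
  have -> : v' 0 i - v' 0 j = v 0 i - v 0 j + - s * ((i \in U)%:R - (j \in U)%:R).
    by rewrite !mxE; ring.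
  by rewrite mulrA -mulNr; exact: ln_link_ge_tangent.
under eq_bigr do rewrite -mulr_sumr.
rewrite -mulr_sumr sum_c mulNr oppr_le0 pmulr_rge0// -mulr_natl pmulr_rge0//.
Qed.

(** Letting s decrease to 0 in the previous bound needs only continuity of the scores, not a
    derivative of the likelihood. *)
Lemma mle_cut_score_ge0 v (U : {set 'I_n}) : is_mle f G x v -> 0 <= cut_score f G x v U.
Proof.
move=> mv; have -> : cut_score f G x v U = cut_s v U 0.
  by rewrite /cut_s; under [RHS]eq_bigr do under eq_bigr do under eq_bigr do rewrite subr0.
have cont : continuous (cut_s v U).
  apply: continuous_sum_seq => i _ iU; apply: continuous_sum_seq => j _ jU.
  apply: continuous_sum_seq => t _ _ s.
  have ij : i != j by apply: contraTneq jU => <-; rewrite inE iU.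
  have [Ax _] := hx ij (ltn_ord t).
  apply: (@continuous_comp _ _ _ (fun s => v 0 i - v 0 j - s) (score f (x i j t))).
    by apply: continuousB; [exact: cst_continuous|exact: id].
  apply: differentiable_continuous; apply/derivable1_diffP.
  by have [] := hconc (v 0 i - v 0 j - s) Ax.
apply: (cvgr_to_ge (f := cut_s v U) (F := 0^'+)).
  exact: (cvg_at_right_filter (cont 0)).
by near=> s; apply: cut_s_ge0.
Unshelve. all: by end_near. Qed.

Lemma cut_scoreC v (U : {set 'I_n}) : cut_score f G x v (~: U) = - cut_score f G x v U.
Proof.
rewrite /cut_score finset.setCK exchange_big -sumrN /=; apply: eq_bigr => i iU.
rewrite -sumrN; apply: eq_bigr => j; rewrite inE => jU.
rewrite -sumrN mult_sym; apply: eq_bigr => t _.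
have ij : i != j by apply: contraNneq jU => <-.
have [Ax ->] := hx ij (ltn_ord t).
by rewrite -(score_opp hA hf hconc)//; congr score; lra.
Qed.

Lemma mle_unique v1 v2 : connected_graph G -> (0 < n)%N ->
  is_mle f G x v1 -> is_mle f G x v2 -> v1 = v2.
Proof.
move=> hG n0 m1 m2; pose D i := v2 0 i - v1 0 i.
pose i1 := [arg max_(i > Ordinal n0) D i]%O.
have i1max i : D i <= D i1 by rewrite /i1; case: arg_maxP => // j _; apply.
pose U := [set i | D i1 <= D i]%SET.
have U0 : U != finset.set0 by apply/finset.set0Pn; exists i1; rewrite inE.
suff UT : U = [set: 'I_n]%SET.
  have DD i : D i = D i1.
    apply/le_anti; rewrite i1max /=; have : i \in U by rewrite UT inE.
    by rewrite inE.
  have D0 : D (Ordinal n0) = 0 by rewrite /D m1.1// m2.1// subrr.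
  apply/rowP => i; apply/eqP; rewrite eq_sym -subr_eq0.
  by rewrite -/(D i) DD -(DD (Ordinal n0)) D0.
apply/eqP/negPn/negP => UT.
have [i [j [iU jU Gij]]] := boundary_edge (boundary_gt0 hG U0 UT).
(* Optimality of v1 on the complement gives S_U (v1) <= 0, so a strict decrease from v1 to v2
   contradicts S_U (v2) >= 0. *)
have h1 := mle_cut_score_ge0 (~: U) m1; have h2 := mle_cut_score_ge0 U m2.
rewrite cut_scoreC oppr_ge0 in h1.
suff : cut_score f G x v2 U < cut_score f G x v1 U.
  by rewrite ltNge (le_trans h1 h2).
have lt_term a b (t : nat) : a \in U -> b \notin U -> (t < G a b)%N ->
    score f (x a b t) (v2 0 a - v2 0 b) < score f (x a b t) (v1 0 a - v1 0 b).
  move=> aU bU tG; have ab : a != b by apply: contraNneq bU => <-.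
  have [Ax _] := hx ab tG; apply: (score_decr hconc) => //.
  by move: aU bU; rewrite !inE -ltNge /D; have := i1max a; rewrite /D; lra.
rewrite /cut_score (bigD1 i) //= [ltRHS](bigD1 i) //=; apply: ltr_leD.
  have jU' : j \in ~: U by rewrite inE.
  rewrite (bigD1 j) //= [ltRHS](bigD1 j) //=; apply: ltr_leD.
    rewrite (bigD1 (Ordinal Gij)) //= [ltRHS](bigD1 (Ordinal Gij)) //=.
    apply: ltr_leD; first exact: lt_term.
    by apply: ler_sum => t _; apply/ltW/lt_term.
  apply: ler_sum => b /andP[]; rewrite inE => bU _.
  by apply: ler_sum => t _; apply/ltW/lt_term.
apply: ler_sum => a /andP[aU _]; apply: ler_sum => b; rewrite inE => bU.
by apply: ler_sum => t _; apply/ltW/lt_term.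
Qed.

End mle_score.

(** * Chaining along level sets *)

Section chaining.
Context (R : realType) (k : outcome_kind) (A : set R) (f : R -> R -> R).
Hypotheses (hA : outcome_space k A) (hf : valid_link k A f)
  (hconc : strictly_log_concave A f).
Context n (G : multigraph n) (x : 'I_n -> 'I_n -> nat -> R) (u v : 'rV[R]_n).
Hypotheses (hx : realizable A G x) (hG : connected_graph G) (n_gt1 : (1 < n)%N)
  (nu : normalized u) (mv : is_mle f G x v).
Variables (M K c : R).
Hypotheses (K_gt0 : 0 < K) (c_gt0 : 0 < c)
  (uM : forall i j, `|u 0 i - u 0 j| <= M)
  (hc : forall y z, A y -> `|z| <= M + 1 -> c <= `|score2 f y z|)
  (hcut : forall U : {set 'I_n}, U != finset.set0 -> U != [set: 'I_n]%SET ->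
    cut_score f G x u U <=
    10 * K * Num.sqrt ((boundary G U * minn #|U| #|~: U|)%:R * ln n%:R)).

Let rate (U : {set 'I_n}) : R := Num.sqrt (ln n%:R / expansion R G U).
(** [tau * rate U] is the step e of the overview. *)
Let tau : R := 20 * K / c.
Let D i := v 0 i - u 0 i.
Let level (a : R) := [set i | a <= D i]%SET.

(* Otherwise more than half of the boundary edges have a gap above
   De = tau * rate, and the cut score at u exceeds its bound. *)
Let level_next a : level a != finset.set0 -> level a != [set: 'I_n]%SET ->
  tau * rate (level a) <= 1 ->
  (boundary G (level a) <= 2 * edges_between G (level a)
     (level (a - tau * rate (level a))%R :\: level a))%N.
Proof.
set U := level a => U0 UT; set De := tau * rate U => De1; set V := level (a - De).
rewrite leqNgt; apply/negP => few.
have tau0 : 0 < tau by rewrite divr_gt0 ?mulr_gt0.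
have De0 : 0 <= De by rewrite mulr_ge0 ?sqrtr_ge0 ?ltW.
have disj (W : {set 'I_n}) : W \subset ~: U -> [disjoint U & W]%B.
  by move=> WU; rewrite finset.disjoints_subset -finset.setCS finset.setCK.
have UV : U \subset V.
  by apply/fintype.subsetP => i; rewrite !inE; lra.
have split_sum (F : 'I_n -> nat) :
    (\sum_(j in ~: U) F j = \sum_(j in V :\: U) F j + \sum_(j in ~: V) F j)%N.
  rewrite (bigID (mem V)) /=; congr (_ + _)%N; apply: eq_bigl => j; rewrite !inE //.
  by have /fintype.subsetP/(_ j) := UV; rewrite !inE; case: (a <= D j) => //= ->.
pose far := (\sum_(i in U) \sum_(j in ~: V) G i j)%N.
have bd : boundary G U = (edges_between G U (V :\: U) + far)%N.
  rewrite boundaryE edges_betweenE; last first.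
    by apply: disj; rewrite finset.setDE finset.subsetIr.
  rewrite /far -big_split /=; apply: eq_bigr => i _; exact: split_sum.
have far2 : (boundary G U < 2 * far)%N by lia.
have N0 : (0 < boundary G U)%N by exact: boundary_gt0.
have m0 : (0 < minn #|U| #|~: U|)%N.
  rewrite leq_min !card_gt0 U0 /=; apply: contraNneq UT => UC.
  by rewrite -[U]finset.setCK UC finset.setC0.
have L0 : 0 < ln (n%:R : R) by rewrite ln_gt0// ltr1n.
have lower : c * De * far%:R <= cut_score f G x u U.
  apply: (@le_trans _ _ (cut_score f G x u U - cut_score f G x v U)); last first.
    by rewrite gerDl oppr_le0; exact: (mle_cut_score_ge0 hA hf hconc hx U mv).
  rewrite /far natr_sum mulr_sumr /cut_score -sumrB; apply: ler_sum => i iU.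
  (* Curvature is used only over the first e of the gap, where it is controlled; monotonicity of the
     score covers the rest. Near edges take e = 0, far ones e = De. *)
  have term (j : 'I_n) (t : nat) e : j \notin U -> (t < G i j)%N ->
      0 <= e -> e <= 1 -> u 0 i - u 0 j + e <= v 0 i - v 0 j ->
      c * e <= score f (x i j t) (u 0 i - u 0 j) - score f (x i j t) (v 0 i - v 0 j).
    move=> jU tG e0 e1 uv; have ij : i != j by apply: contraNneq jU => <-.
    have [Ax _] := hx ij tG.
    apply: (le_trans (score_gap hconc Ax (uM i j) e0 e1 (fun z => hc Ax))).
    by rewrite lerD2l lerN2; exact: (score_decrW hconc Ax uv).
  rewrite natr_sum mulr_sumr -sumrB [leRHS](bigID (mem V)) /=.
  apply: ler_wpDl.
    apply: sumr_ge0 => j /andP[]; rewrite inE => jU _; rewrite -sumrB.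
    apply: sumr_ge0 => t _; rewrite -[leLHS](mulr0 c); apply: term => //.
    by move: iU jU; rewrite !inE -ltNge /D; lra.
  rewrite [leRHS](eq_bigl (fun j => j \in ~: V)); last first.
    move=> j; rewrite !inE; have /fintype.subsetP/(_ j) := UV; rewrite !inE.
    by case: (a <= D j) => //= ->.
  apply: ler_sum => j; rewrite inE => jV.
  have jU : j \notin U by apply: contraNN jV; exact: (fintype.subsetP UV).
  rewrite -sumrB -[X in _ * X%:R](card_ord (G i j)) -sum1_card natr_sum mulr_sumr.
  apply: ler_sum => t _; rewrite mulr1; apply: term => //.
  by move: iU jV; rewrite !inE -ltNge /D; lra.
have := le_trans lower (hcut U0 UT).
rewrite natrM; set N := (boundary G U)%:R; set m := (minn _ _)%:R.
have N0' : 0 < N by rewrite ltr0n.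
have m0' : 0 < m by rewrite ltr0n.
have far2' : N < 2 * far%:R by rewrite -natrM ltr_nat.
have rE : rate U = Num.sqrt (N * m * ln n%:R) / N.
  rewrite /rate /expansion -/N -/m.
  have -> : ln n%:R / (N / m) = N * m * ln n%:R / N ^+ 2 by field; rewrite !gt_eqF.
  rewrite sqrtrM; last by rewrite !mulr_ge0 ?ltW.
  by rewrite sqrtrV ?sqr_ge0// sqrtr_sqr gtr0_norm.
have s0 : 0 < Num.sqrt (N * m * ln n%:R) by rewrite sqrtr_gt0 !mulr_gt0.
rewrite leNgt => /negP; apply.
have -> : c * De * far%:R = 10 * K * Num.sqrt (N * m * ln n%:R) * (2 * far%:R / N).
  by rewrite /De /tau rE; field; rewrite !gt_eqF.
by rewrite ltr_pMr ?mulr_gt0// ltr_pdivlMr// mul1r.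
Qed.

Let admissible_cons (U V : {set 'I_n}) s :
  admissible G (V :: s) -> U != finset.set0 -> U \proper V ->
  (boundary G U <= 2 * edges_between G U (V :\: U))%N ->
  admissible G (U :: V :: s).
Proof.
move=> /and3P[_ /= /andP[V0 al] so] U0 UV b.
by apply/and3P; split => //=; rewrite ?U0 ?V0 ?UV ?b.
Qed.

Let admissibleT : admissible G [:: [set: 'I_n]%SET].
Proof.
apply/and3P; split => //=; rewrite andbT; apply/finset.set0Pn.
by exists (Ordinal (ltnW n_gt1)); rewrite inE.
Qed.

Lemma level_chain (Gam : R) :
  (forall s, admissible G s ->
    \sum_(0 <= i < (size s).-1) rate (nth finset.set0 s i) <= Gam) ->
  tau * Gam <= 1 ->
  forall i, `|v 0 i - u 0 i| <= tau * Gam.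
Proof.
move=> hGam tauGam; have tau0 : 0 < tau by rewrite divr_gt0 ?mulr_gt0.
(* The two-term sequence U, [n] is admissible, so a single rate is at most Gamma; hence no level
   step exceeds 1. *)
have rate_le U : U != finset.set0 -> U != [set: 'I_n]%SET -> rate U <= Gam.
  move=> U0 UT; have := hGam [:: U; [set: 'I_n]%SET]; rewrite /= big_nat1; apply.
  apply: admissible_cons => //.
    by rewrite finset.properEneq UT finset.subsetT.
  by rewrite finset.setTD /boundary; lia.
(* Induction on the size of the complement. Summing over [size s] indices of [level a :: s] leaves
   out its last set, which is all of [n], as in Gamma. *)
have chain m : forall a, (#|~: level a| <= m)%N -> level a != finset.set0 ->
    exists s, admissible G (level a :: s) /\ forall i,
      a - D i <= tau * \sum_(0 <= l < size s) rate (nth finset.set0 (level a :: s) l).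
  elim: m => [|m IH] a am a0.
    have lT : level a = [set: 'I_n]%SET.
      move: am; rewrite leqn0 cards_eq0 => /eqP lC.
      by rewrite -[LHS]finset.setCK lC finset.setC0.
    exists [::]; rewrite lT; split => // i; rewrite big_nil mulr0 subr_le0.
    have : i \in level a by rewrite lT inE.
    by rewrite inE.
  have [lT|lT] := eqVneq (level a) [set: 'I_n]%SET.
    exists [::]; rewrite lT; split => // i; rewrite big_nil mulr0 subr_le0.
    have : i \in level a by rewrite lT inE.
    by rewrite inE.
  set De := tau * rate (level a); pose V := level (a - De).
  have De0 : 0 <= De by rewrite mulr_ge0 ?sqrtr_ge0 ?ltW.
  have De1 : De <= 1.
    by apply: le_trans tauGam; rewrite ler_pM2l//; exact: rate_le.
  have nxt := level_next a0 lT De1; rewrite -/De -/V in nxt.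
  have UV : level a \subset V.
    by apply/fintype.subsetP => i; rewrite !inE; lra.
  have UpV : level a \proper V.
    (* The level set grows strictly: otherwise no edge would join it to the empty difference, while
       connectedness gives it a nonempty boundary. *)
    rewrite finset.properEneq UV andbT; apply/eqP => E; move: nxt; rewrite -E finset.setDv.
    rewrite edges_betweenE; last by rewrite finset.disjoints_subset finset.setC0 finset.subsetT.
    rewrite big1 ?muln0; last by move=> i _; rewrite big_set0.
    by rewrite leqNgt boundary_gt0.
  have Vm : (#|~: V| <= m)%N.
    by have := proper_card UpV; have := cardsC V; have := cardsC (level a); lia.
  have V0 : V != finset.set0.
    move/finset.set0Pn: a0 => [i ia]; apply/finset.set0Pn; exists i; exact: (fintype.subsetP UV).
  have [s [ads hs]] := IH (a - De) Vm V0.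
  exists (V :: s); split; first exact: admissible_cons.
  move=> i; rewrite /= big_nat_recl//= mulrDr -/De.
  by have := hs i; rewrite -/V; lra.
pose i1 := [arg max_(i > Ordinal (ltnW n_gt1)) D i]%O.
have i1max i : D i <= D i1 by rewrite /i1; case: arg_maxP => // j _; apply.
have [|s [ads hs]] := chain _ (D i1) (leqnn _).
  by apply/finset.set0Pn; exists i1; rewrite inE.
have hs' i : D i1 - D i <= tau * Gam.
  by apply: (le_trans (hs i)); rewrite ler_pM2l//; exact: (hGam _ ads).
have D0 : D (Ordinal (ltnW n_gt1)) = 0 by rewrite /D nu// mv.1// subrr.
move=> i; have := hs' i; have := hs' (Ordinal (ltnW n_gt1)).
have := i1max i; have := i1max (Ordinal (ltnW n_gt1)); rewrite D0 -/(D i) => h1 h2 h3 h4.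
by rewrite ler_norml; apply/andP; split; lra.
Qed.

End chaining.

(** * Finiteness of the constants and assembly of the rate *)

Lemma min_div_mul_finite (R : realType) (a b : R) (c Gam : \bar R) :
  0 < a -> 0 <= b -> (0 < c)%E -> (0 < Gam)%E ->
  (Order.min (a%:E / b%:E) (c / b%:E) * Gam < +oo)%E ->
  exists K gam : R,
    [/\ 0 < b, 0 < K, Gam = gam%:E, K = a \/ c = K%:E
      & (Order.min (a%:E / b%:E) (c / b%:E) * Gam = (K / b * gam)%:E)%E].
Proof.
move=> a0 b0 c0 G0; rewrite inver.
(* At b = 0 both quotients are +oo, and so is their product with a positive Gam, against
   finiteness. *)
move: b0; rewrite le_eqVlt => /predU1P[<-|b0].
  by rewrite eqxx !gt0_muley ?lte_fin// minxx gt0_mulye// ltxx.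
rewrite gt_eqF//.
have [K K0 [-> KE]] : exists2 K : R, 0 < K &
    Order.min (a%:E * b^-1%:E)%E (c * b^-1%:E)%E = (K / b)%:E /\ (K = a \/ c = K%:E).
  case: c c0 => [r||]//; rewrite ?lte_fin => r0.
    rewrite -!EFinM /Order.min; case: ifP => _; [exists a|exists r] => //;
      split => //; [left|right] => //.
  rewrite gt0_mulye ?lte_fin ?invr_gt0//; exists a => //; split; last by left.
  by rewrite -EFinM /Order.min ltry.
case: Gam G0 => [g g0 _|_|]//; last by rewrite gt0_muley ?lte_fin ?divr_gt0// ltxx.
by exists K, g; split => //; rewrite EFinM.
Qed.

Lemma le_dynamic_range (R : realType) n (u : 'rV[R]_n) i j :
  `|u 0 i - u 0 j| <= dynamic_range u.
Proof.
apply: (@le_trans _ _ (\big[Num.max/0]_(j < n) `|u 0 i - u 0 j|)).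
  exact: (le_bigmax_cond _ (fun j => `|u 0 i - u 0 j|)).
exact: (le_bigmax_cond _ (fun i => \big[Num.max/0]_(j < n) `|u 0 i - u 0 j|)).
Qed.

Lemma dynamic_range_ge0 (R : realType) n (u : 'rV[R]_n) : 0 <= dynamic_range u.
Proof. exact: bigmax_ge_id. Qed.

Lemma rV_norm_le (R : realType) n (v : 'rV[R]_n) (r : R) :
  0 <= r -> (forall i, `|v 0 i| <= r) -> `|v| <= r.
Proof.
move=> r0 hv; rewrite /Num.norm /= mx_normrE; apply: bigmax_le => // -[i j] _ /=.
by rewrite ord1.
Qed.

(** Since 0 times +oo is 0, positivity is what allows finiteness of Delta to exclude an infinite
    omega. A singleton followed by [n] is a witness. *)
Lemma GammaRE_gt0 (R : realType) n (G : multigraph n) :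
  connected_graph G -> (1 < n)%N -> (0 < GammaRE R G)%E.
Proof.
move=> hG n1; pose U := [set Ordinal (ltnW n1)]%SET.
have U0 : U != finset.set0 by apply/finset.set0Pn; exists (Ordinal (ltnW n1)); rewrite inE.
have cU : #|U| = 1%N by rewrite cards1.
have UT : U != [set: 'I_n]%SET.
  by apply/eqP => UT; move: cU; rewrite UT cardsT card_ord => n1E; move: (n1); rewrite n1E ltnn.
have N0 := boundary_gt0 hG U0 UT.
apply: (@lt_le_trans _ _ (Num.sqrt (ln n%:R / expansion R G U))%:E); last first.
  apply: ereal_sup_ubound; exists [:: U; [set: 'I_n]%SET]; last by rewrite big_nat1.
  apply/and3P; split => //=.
    rewrite U0 andbT; apply/finset.set0Pn.
    by exists (Ordinal (ltnW n1)); rewrite inE.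
  by rewrite finset.properEneq UT finset.subsetT finset.setTD andbT /= /boundary leq_pmull.
rewrite lte_fin sqrtr_gt0 divr_gt0 ?ln_gt0 ?ltr1n// /expansion divr_gt0 ?ltr0n//.
have E := cardsC U; rewrite card_ord cU in E.
by rewrite cU leq_min /= -(ltn_add2l 1) addn0 E.
Qed.

(** Total mass 1 rules out an empty A; a point of A keeps [score2_inf] from being +oo and
    [score_sup] from being -oo. *)
Lemma outcome_space_nonempty (R : realType) k (A : set R) f :
  valid_link k A f -> exists x, A x.
Proof.
move=> hf; apply: contrapT => /forallNP A0.
have AE : A = set0 by apply/seteqP; split => x // /A0.
have := link_mass1 hf 0; rewrite AE; case: (k) => /=; rewrite ?integral_set0 ?esum_set0.
  by move=> /esym/eqP; rewrite onee_eq0.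
by move=> /esym/eqP; rewrite onee_eq0.
Qed.

Section rate.
Context (R : realType) (k : outcome_kind) (A : set R) (f : R -> R -> R).
Hypotheses (hA : outcome_space k A) (hf : valid_link k A f)
  (hconc : strictly_log_concave A f).
Context n (G : multigraph n) (u : 'rV[R]_n).
Hypotheses (hG : connected_graph G) (hu : normalized u).
Context d (T : measurableType d) (P : probability T R)
  (X : 'I_n -> 'I_n -> nat -> {RV P >-> R}).
Hypothesis hX : comparison_outcomes k A f G u X.
Context dY (TY : measurableType dY) (PY : probability TY R) (Y : R -> {RV PY >-> R}).
Hypothesis hY : forall y, has_density k A (f ^~ y) (Y y).
Variable C4 : R.
Hypothesis hC4 : (ereal_sup [set psi2_norm PY (fun w : TY =>
           (score f (Y y w) y
            - fine ('E_PY[fun w' : TY => score f (Y y w') y])%E)%R)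
         | y in [set y : R | (`|y| <= dynamic_range u)%R]]
       <= C4%:E)%E.

Let M := dynamic_range u.

Let score_sup_mgf (B : R) : score_sup A f M = B%:E ->
  0 < B /\ forall y lam : R, `|y| <= M ->
    ('E_PY[fun w => expR (lam * score f (Y y w) y)]
       <= (expR (5 * lam ^+ 2 * (4 * B) ^+ 2))%:E)%E.
Proof.
move=> BE; have leB x y : A x -> `|y| <= M -> `|score f x y| <= B.
  by move=> Ax yM; rewrite -lee_fin -BE; apply: ereal_sup_ubound; exists x, y.
have M0 : `|0 : R| <= M by rewrite normr0 dynamic_range_ge0.
have B0 : 0 < B.
  have [x0 Ax0] := outcome_space_nonempty hf.
  rewrite lt_neqAle (le_trans (normr_ge0 _) (leB x0 0 Ax0 M0)) andbT.
  (* If the bound were 0, the score at y = 0 would vanish and E exp (g) would equal 1. *)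
  apply/eqP => B0; have := score_mgf_gt1 hA hf hconc (hY 0) (oner_neq0 R).
  rewrite unlock; under eq_integral => w _.
    have -> : score f (Y 0 w) 0 = 0.
      by apply/eqP; rewrite -normr_le0; apply: le_trans (leB _ 0 ((hY 0).1 w) M0) _; rewrite -B0.
    rewrite mulr0 expR0; over.
  by have /= -> := integral_cst PY measurableT 1%:E; rewrite probability_setT mule1 ltxx.
split => // y lam yM.
have := psi2_norm_score_bounded hA hf hconc (hY y) B0 (fun x Ax => leB x y Ax yM).
by move=> /(psi2_norm_score_mgf hA hf hconc (hY y)) [_]; exact.
Qed.

Let C4_mgf : 0 < C4 /\ forall y lam : R, `|y| <= M ->
    ('E_PY[fun w => expR (lam * score f (Y y w) y)]
       <= (expR (5 * lam ^+ 2 * C4 ^+ 2))%:E)%E.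
Proof.
have H y : `|y| <= M -> 0 < C4 /\ forall lam : R,
    ('E_PY[fun w => expR (lam * score f (Y y w) y)]
       <= (expR (5 * lam ^+ 2 * C4 ^+ 2))%:E)%E.
  move=> yM; apply: (psi2_norm_score_mgf hA hf hconc (hY y)).
  by apply: le_trans hC4; apply: ereal_sup_ubound; exists y.
split; last by move=> y lam /H[_]; exact.
by have [|] := H 0; rewrite ?normr0 ?dynamic_range_ge0.
Qed.

(** Strong connectivity is used pointwise, and only for the existence of a maximizer, so the event
    is the concentration event alone. *)
Lemma mle_rate : (1 < n)%N -> (DeltaRE A f G u C4 < (80^-1)%:E)%E ->
  exists E : set T,
     [/\ measurable E, ((1 - n%:R ^- 2)%:E <= P E)%E
       & forall w, E w -> strongly_connected G (fun i j t => X i j t w) ->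
           mle_within f G (fun i j t => X i j t w) u (80%:E * DeltaRE A f G u C4)%E].
Proof.
move=> n1 small; have [C40 mgf4] := C4_mgf.
have [x0 Ax0] := outcome_space_nonempty hf.
have M0 : 0 <= M := dynamic_range_ge0 u.
have C3_ge0 : (0 <= score2_inf A f M)%E.
  by apply: le_ereal_inf_tmp => _ [x [y [_ _ ->]]]; rewrite lee_fin.
have C3_le x z : A x -> `|z| <= M + 1 -> (score2_inf A f M <= `|score2 f x z|%:E)%E.
  by move=> Ax zM; apply: ereal_inf_lbound; exists x, z.
have [b C3E] : exists b, score2_inf A f M = b%:E.
  exists (fine (score2_inf A f M)); rewrite fineK// ge0_fin_numE//.
  by apply: (le_lt_trans (C3_le x0 0 Ax0 _)); rewrite ?ltry// normr0 addr_ge0.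
have b0 : 0 <= b by rewrite -lee_fin -C3E.
have C2_gt0 : (0 < score_sup A f M)%E.
  have : (`|score f x0 0|%:E <= score_sup A f M)%E.
    by apply: ereal_sup_ubound; exists x0, 0; rewrite normr0.
  case E2 : (score_sup A f M) => [B| |] //; first by rewrite lte_fin; have [] := score_sup_mgf E2.
have finD : (DeltaRE A f G u C4 < +oo)%E by apply: (lt_trans small); rewrite ltry.
rewrite /DeltaRE /omega C3E in small finD *.
have [K [gam [{}b0 K0 GE KE DE]]] :=
  min_div_mul_finite C40 b0 C2_gt0 (GammaRE_gt0 R hG n1) finD.
rewrite DE in small *.
have gam_ge s : admissible G s -> \sum_(0 <= l < (size s).-1)
    Num.sqrt (ln n%:R / expansion R G (nth finset.set0 s l)) <= gam.
  by move=> ads; rewrite -lee_fin -GE; apply: ereal_sup_ubound; exists s.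
have gam0 : 0 < gam by rewrite -lte_fin -GE GammaRE_gt0.
(* The sub-gaussian constant is C4 or 4 C2, according to which numerator attains the minimum in
   omega; 4 K covers both. *)
have [K' [K'0 K'K mgf]] : exists K' : R, [/\ 0 < K', K' <= 4 * K &
    forall y lam : R, `|y| <= M -> ('E_PY[fun w => expR (lam * score f (Y y w) y)]
       <= (expR (5 * lam ^+ 2 * K' ^+ 2))%:E)%E].
  case: KE => [->|/score_sup_mgf[_ mgf2]].
    by exists C4; split => //; lra.
  by exists (4 * K); split => //; rewrite mulr_gt0.
have uM := le_dynamic_range u.
have [E [mE PE HE]] := cut_score_concentration hA hf hconc hX hY mgf uM K'0 hG n1.
exists E; split => // w Ew sc.
have hx := comparison_outcomes_realizable hA hX w.
have [v mv] := mle_exists hf hconc hx (ltnW n1) sc.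
have tau_le : 20 * K' / b * gam <= 80 * (K / b * gam).
  rewrite !mulrA; apply: ler_wpM2r; first exact: ltW.
  by apply: ler_wpM2r; [rewrite invr_ge0 ltW|lra].
have tau1 : 20 * K' / b * gam <= 1.
  by apply: (le_trans tau_le); move: small; rewrite lte_fin; lra.
have hc x z : A x -> `|z| <= M + 1 -> b <= `|score2 f x z|.
  by move=> Ax zM; rewrite -lee_fin -C3E; exact: C3_le.
have close := level_chain hA hf hconc hx hG n1 hu mv K'0 b0 uM hc (HE w Ew) gam_ge tau1.
exists v; split.
  by split => // v' mv'; exact: (mle_unique hA hf hconc hx hG (ltnW n1)).
rewrite -EFinM lee_fin; apply: rV_norm_le => [|i].
  by rewrite !mulr_ge0 ?invr_ge0 ?ltW.
by rewrite !mxE; apply: le_trans tau_le.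
Qed.

End rate.

Lemma cvg_probability1 (R : realType) (p : nat -> \bar R) (N : nat) :
  (forall n, (p n <= 1)%E) ->
  (forall n, (N <= n)%N -> ((1 - n%:R ^- 2)%:E <= p n)%E) ->
  p @ \oo --> 1%:E.
Proof.
move=> p1 pN; apply: (@squeeze_cvge _ _ _ _ (fun n => (1 - 2 * harmonic n)%:E) _ (cst 1%:E)).
- near=> n; rewrite p1 andbT.
  have n0 : (0 < n)%N by near: n; exists 1%N.
  apply: le_trans (pN n _); last by near: n; exists N.
  have n1 : 1 <= n%:R :> R by rewrite ler1n.
  (* [harmonic n] is 1 / (n + 1), and n^-2 <= 2 / (n + 1) for n >= 1. *)
  rewrite lee_fin lerD2l lerN2 /harmonic -natr1.
  rewrite -[leLHS]div1r ler_pdivrMr ?exprn_gt0 ?(lt_le_trans ltr01)//.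
  rewrite mulrAC ler_pdivlMr; last by lra.
  nra.
- apply: cvg_EFin; first exact: nearW.
  rewrite -[X in _ --> X]subr0 -[X in _ - X](mulr0 2).
  apply: cvgB; first exact: cvg_cst.
  by apply: cvgMr; exact: cvg_harmonic.
- exact: cvg_cst.
Unshelve. all: by end_near. Qed.

Lemma cvge0_near_lt (R : realType) (D : nat -> \bar R) (r : R) :
  D @ \oo --> 0%E -> 0 < r -> \forall n \near \oo, (D n < r%:E)%E.
Proof.
move=> D0 r0; have H : nbhs (0%E : \bar R) [set y | (y < r%:E)%E].
  by apply: open_nbhs_nbhs; split; [exact: open_ereal_lt_ereal|rewrite /= lte_fin].
exact: (D0 _ H).
Qed.

Theorem theorem4 (R : realType) :
  exists C : R, 0 < C /\
  forall (k : outcome_kind) (A : set R) (f : R -> R -> R)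
    (hA : outcome_space k A)
    (hf : valid_link k A f)
    (hconc : strictly_log_concave A f)
    (G : forall n, multigraph n)
    (hG : forall n, connected_graph (G n))
    (u : forall n, 'rV[R]_n)
    (hu : forall n, normalized (u n))
    (d : nat -> measure_display)
    (T : forall n, measurableType (d n))
    (P : forall n, probability (T n) R)
    (X : forall n, 'I_n -> 'I_n -> nat -> {RV P n >-> R})
    (hX : forall n, comparison_outcomes k A f (G n) (u n) (X n))
    (dY : measure_display) (TY : measurableType dY) (PY : probability TY R)
    (Y : R -> {RV PY >-> R})
    (hY : forall y, has_density k A (f ^~ y) (Y y))
    (C4 : nat -> R)
    (hC4 : forall n,
      (ereal_sup [set psi2_norm PY (fun w : TY =>
           (score f (Y y w) y
            - fine ('E_PY[fun w' : TY => score f (Y y w') y])%E)%R)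
         | y in [set y : R | (`|y| <= dynamic_range (u n))%R]]
       <= (C4 n)%:E)%E)
    (hRE : (fun n => DeltaRE A f (G n) (u n) (C4 n)) @ \oo --> 0%E),
  (\forall n \near \oo, exists E : set (T n),
     [/\ measurable E,
         ((1 - n%:R ^- 2)%:E <= P n E)%E
       & forall w, E w ->
           strongly_connected (G n) (fun i j t => X n i j t w) ->
           mle_within f (G n) (fun i j t => X n i j t w) (u n)
             (C%:E * DeltaRE A f (G n) (u n) (C4 n))%E])
  /\
  (forall eps : R, 0 < eps ->
   exists E : forall n, set (T n),
     [/\ forall n, measurable (E n),
         (fun n => P n (E n)) @ \oo --> 1%E
       & forall n w, E n w ->
           strongly_connected (G n) (fun i j t => X n i j t w) ->
           mle_within f (G n) (fun i j t => X n i j t w) (u n) eps%:E]).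
Proof.
exists 80; split => // k A f hA hf hconc G hG u hu d T P X hX dY TY PY Y hY C4 hC4 hRE.
have rate n : (1 < n)%N -> (DeltaRE A f (G n) (u n) (C4 n) < (80^-1)%:E)%E -> _ :=
  mle_rate hA hf hconc (hG n) (hu n) (hX n) hY (hC4 n).
have c80 : 0 < 80^-1 :> R by rewrite invr_gt0.
split.
  have D80 := cvge0_near_lt hRE c80.
  near=> n; apply: rate; last by near: n.
  by near: n; exists 2%N.
move=> eps eps0.
(* The first bound activates the rate, the second turns 80 Delta into at most eps. *)
have /(cvge0_near_lt hRE) [N _ HN] : 0 < Num.min 80^-1 (eps / 80).
  by rewrite lt_min c80 divr_gt0.
have ex n : exists E : set (T n), [/\ measurable E,
    (maxn 2 N <= n)%N -> ((1 - n%:R ^- 2)%:E <= P n E)%E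
  & forall w, E w -> strongly_connected (G n) (fun i j t => X n i j t w) ->
      mle_within f (G n) (fun i j t => X n i j t w) (u n) eps%:E].
  (* For small n the empty event meets the requirements vacuously and does not affect the limit. *)
  have [|nN] := leqP (maxn 2 N) n; last by exists set0; split.
  rewrite geq_max => /andP[n2 nN].
  have Dn : (DeltaRE A f (G n) (u n) (C4 n) < (Num.min 80^-1 (eps / 80))%:E)%E by exact: HN.
  have [|E [mE PE HE]] := rate n n2.
    by apply: (lt_le_trans Dn); rewrite lee_fin ge_min lexx.
  exists E; split => // w Ew sc; have [v [mv vD]] := HE w Ew sc.
  exists v; split => //; apply: (le_trans vD).
  apply: (@le_trans _ _ (80%:E * (eps / 80)%:E)%E); last first.
    by rewrite -EFinM lee_fin mulrCA divff// mulr1.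
  apply: lee_wpmul2l => //; apply/ltW/(lt_le_trans Dn).
  by rewrite lee_fin ge_min lexx orbT.
exists (fun n => projT1 (cid (ex n))); split.
- by move=> n; case: (cid (ex n)) => E [].
- apply: (@cvg_probability1 _ _ (maxn 2 N)) => n; case: (cid (ex n)) => E [mE PE _] //=.
  exact: probability_le1.
- by move=> n w; case: (cid (ex n)) => E [mE PE HE] /=; exact: HE.
Unshelve. all: by end_near. Qed.
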